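(* Let $x>0$ and let $\kappa,\mu$ be complex numbers with $\mathrm{Re}\left(\frac12+\mu-\kappa\right)>0$. Then $$\mathrm{wi}_{\kappa,\mu}(x)=\frac{1}{\Gamma\left(\frac12+\mu-\kappa\right)}\int_0^\infty\frac{t^{\mu-\kappa-1/2}(1+t)^{\mu+\kappa-1/2}}{\left(\frac12+t\right)^{\mu+1/2}}\,\Gamma\left(\frac12+\mu,\,x\left(t+\frac12\right)\right)dt.$$
   Context: The integral Whittaker function $\mathrm{wi}$ is $\mathrm{wi}_{\kappa,\mu}(x)=\int_x^\infty\frac{\mathrm{W}_{\kappa,\mu}(t)}{t}\,dt$, where for $t>0$ the Whittaker function is $\mathrm{W}_{\kappa,\mu}(t)=e^{-t/2}t^{\mu+1/2}\,\mathrm{U}\left(\frac12+\mu-\kappa,1+2\mu,t\right)$ with $\mathrm{U}$ the Tricomi confluent hypergeometric function. $\Gamma(\nu,z)=\int_z^\infty t^{\nu-1}e^{-t}\,dt$ is the upper incomplete gamma function. *)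

(* Defs.v *)
From HB Require Import structures.
From mathcomp Require Import all_boot all_order all_algebra.
From mathcomp Require Import complex.
From mathcomp Require Import all_classical all_reals all_analysis.

Set Implicit Arguments.
Unset Strict Implicit.
Unset Printing Implicit Defensive.

Import Order.TTheory GRing.Theory Num.Theory.
Import numFieldNormedType.Exports.

Local Open Scope classical_set_scope.
Local Open Scope ring_scope.
Local Open Scope complex_scope.

Section ComplexValued.
Context {R : realType}.
Implicit Types (D : set R) (f : R -> R[i]) (t : R) (z : R[i]).

(* t ^ z = exp (z ln t), principal branch; meaningful for t > 0 only. *)
Definition cpow t z : R[i] :=
  let r := expR (complex.Re z * ln t) in
  let theta := complex.Im z * ln t in
  (r * cos theta) +i* (r * sin theta).

(* Lebesgue integral of a complex-valued function of a real variable; it is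
   meaningful when the function is absolutely integrable ([cintegrable]). *)
Definition cintegrable D f : Prop :=
  (@lebesgue_measure R).-integrable D (fun t => (complex.Re (f t))%:E) /\
  (@lebesgue_measure R).-integrable D (fun t => (complex.Im (f t))%:E).

Definition cintegral D f : R[i] :=
  (\int[@lebesgue_measure R]_(t in D) complex.Re (f t)) +i*
  (\int[@lebesgue_measure R]_(t in D) complex.Im (f t)).

Definition cderivable f t : Prop :=
  derivable (fun s => complex.Re (f s)) t 1 /\
  derivable (fun s => complex.Im (f s)) t 1.

Definition cderive f t : R[i] :=
  derive1 (fun s => complex.Re (f s)) t +i* derive1 (fun s => complex.Im (f s)) t.

End ComplexValued.

Section SpecialFunctions.
Context {R : realType}.
Implicit Types (t x : R) (a b z nu kappa mu : R[i]).

(* Upper incomplete gamma function, for a real lower limit x > 0. *)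
Definition upper_Gamma nu x : R[i] :=
  cintegral `]x, +oo[ (fun t => cpow t (nu - 1) * (expR (- t))%:C).

(* Euler's integral: this is the Gamma function on the half-plane Re z > 0. *)
Definition Gamma z : R[i] :=
  cintegral `]0, +oo[ (fun t => cpow t (z - 1) * (expR (- t))%:C).

(* On ]0, +oo[, U(a, b, .) is the solution w of Kummer's equation
     t w'' + (b - t) w' - a w = 0   with   w(t) ~ t ^ (- a) as t -> +oo.
   These conditions determine w on ]0, +oo[ for all complex a and b, since the
   solutions that are not multiples of U(a, b, .) grow like e^t t ^ (a - b). *)
Definition is_tricomiU a b (w : R -> R[i]) : Prop :=
  (forall t, 0 < t ->
    [/\ cderivable w t,
        cderivable (cderive w) t &
        t%:C * cderive (cderive w) t + (b - t%:C) * cderive w t - a * w t = 0])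
  /\ (Normc.normc (w t / cpow t (- a) - 1) @[t --> +oo] --> (0 : R)).

(* The values at t <= 0 are irrelevant. *)
Definition tricomiU a b : R -> R[i] := xget (fun=> 0) (is_tricomiU a b).

Definition whittakerW kappa mu t : R[i] :=
  (expR (- t / 2))%:C * cpow t (mu + 2^-1) *
  tricomiU (2^-1 + mu - kappa) (1 + 2 * mu) t.

Definition wi_integrand kappa mu t : R[i] := whittakerW kappa mu t / t%:C.

Definition wi kappa mu x : R[i] :=
  cintegral `]x, +oo[ (wi_integrand kappa mu).

End SpecialFunctions.

(* Main.v *)
Require Import Defs.
From mathcomp Require Import all_boot all_order all_algebra.
From mathcomp Require Import complex.
From mathcomp Require Import ring lra.
From mathcomp Require Import all_classical all_reals all_analysis.
From mathcomp Require Import measurable_realfun.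

(** Put [a = 1/2 + mu - kappa] and [b = 1 + 2 mu].  For [t > 0],
    [I t = \int_0^oo e^(-ts) s^(a-1) (1+s)^(b-a-1) ds] solves Kummer's equation:
    differentiating under the integral turns the equation into
    [\int_0^oo d/ds (e^(-ts) s^a (1+s)^(b-a)) ds = 0].  Scaling and dominated
    convergence give [t^a I(t) -> Gamma a], and [Gamma a <> 0] because
    [Gamma (a + n)], a Gamma-density average of [s^(i Im a)], has modulus
    comparable to [Gamma (Re a + n)] for large [n].

    Any other solution [w] with [w(t) ~ t^(-a)] is [I / Gamma a]: if [d] is their
    difference, the Wronskian equals [k e^t t^(-b)], so that
    [r = (d / w) e^(-t) t^(b-2a)] satisfies [r -> 0] and [r' -> k].  Hence [k = 0],
    [d / w] is eventually constant and tends to 0, and [d] vanishes near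
    infinity, hence everywhere by a backward Gronwall estimate.

    So [U] has its Laplace integral representation; inserting it in [wi] and
    exchanging the integrals by Fubini's theorem, the integral over [t > x]
    becomes an incomplete Gamma function after [v = (s + 1/2) t]. *)

Import Order.TTheory GRing.Theory Num.Theory.
Import numFieldNormedType.Exports.

Local Open Scope classical_set_scope.
Local Open Scope ring_scope.
Local Open Scope complex_scope.

Set Implicit Arguments.
Unset Strict Implicit.
Unset Printing Implicit Defensive.

(** [tricomiU] is picked by [xget] among the functions satisfying [is_tricomiU], so nothing is known
    about it until that predicate is shown to be inhabited and to fix the values on the positive
    axis. Uniqueness has to come from the differential equation and the limit alone. That limit
    controls [w] but says nothing about [w'], so the Wronskian cannot be evaluated at infinity
    directly. The weight [e^(-t) t^(b-2a)] is made to cancel the growth of the derivative of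
    [d / w]: what remains is small by information on values only, and the mean value theorem carries
    this over to its derivative. Existence needs division by [Gamma a] for a complex [a]. Euler's
    integral at [a] oscillates and shows no lower bound; shifting [a] by [n] concentrates the
    density around [s = Re a + n], at a relative width tending to 0, and there [s^(i Im a)] hardly
    turns. Fubini's theorem rests on [e^(-ts) <= e^(-xs)] for [t > x]: the majorant becomes a
    product of one function of [t] and one of [s]. *)

Local Notation Re := (@complex.Re _).
Local Notation Im := (@complex.Im _).
Local Notation normc := (@Normc.normc _).

(** * Real part, imaginary part and modulus *)

Section ComplexAlgebra.
Context {R : realType}.
Implicit Types (r s t : R) (z w : R[i]).

Lemma complex_ext z w : Re z = Re w -> Im z = Im w -> z = w.
Proof. by case: z w => [a b] [c d] /= -> ->. Qed.

Lemma Re_add z w : Re (z + w) = Re z + Re w. Proof. by case: z w => [a b] []. Qed.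
Lemma Im_add z w : Im (z + w) = Im z + Im w. Proof. by case: z w => [a b] []. Qed.
Lemma Re_opp z : Re (- z) = - Re z. Proof. by case: z. Qed.
Lemma Im_opp z : Im (- z) = - Im z. Proof. by case: z. Qed.
Lemma Re_mul z w : Re (z * w) = Re z * Re w - Im z * Im w.
Proof. by case: z w => [a b] []. Qed.
Lemma Im_mul z w : Im (z * w) = Re z * Im w + Im z * Re w.
Proof. by case: z w => [a b] []. Qed.
Lemma Re_inv z : Re z^-1 = Re z / (Re z ^+ 2 + Im z ^+ 2).
Proof. by case: z. Qed.
Lemma Im_inv z : Im z^-1 = - (Im z / (Re z ^+ 2 + Im z ^+ 2)).
Proof. by case: z. Qed.

Definition ReImE := (Re_add, Im_add, Re_opp, Im_opp, Re_mul, Im_mul).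

Lemma normcE z : normc z = Num.sqrt (Re z ^+ 2 + Im z ^+ 2).
Proof. by case: z. Qed.

Lemma sqr_normc_ReIm z : normc z ^+ 2 = Re z ^+ 2 + Im z ^+ 2.
Proof. by rewrite normcE sqr_sqrtr// addr_ge0// sqr_ge0. Qed.

Lemma normc_ge0 z : 0 <= normc z.
Proof. by rewrite normcE sqrtr_ge0. Qed.

Lemma normc_eq0 z : (normc z == 0) = (z == 0).
Proof.
by apply/eqP/eqP => [/Normc.eq0_normc//|->]; rewrite Normc.normc0.
Qed.

Lemma normr_Re_le z : `|Re z| <= normc z.
Proof. by rewrite normcE -sqrtr_sqr ler_sqrt ?lerDl ?sqr_ge0// addr_ge0 ?sqr_ge0. Qed.

Lemma normr_Im_le z : `|Im z| <= normc z.
Proof. by rewrite normcE -sqrtr_sqr ler_sqrt ?lerDr ?sqr_ge0// addr_ge0 ?sqr_ge0. Qed.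

Lemma normc_le_ReIm z : normc z <= `|Re z| + `|Im z|.
Proof.
rewrite normcE -[leRHS]ger0_norm ?addr_ge0// -sqrtr_sqr ler_sqrt ?sqr_ge0//.
rewrite -(real_normK (num_real (Re z))) -(real_normK (num_real (Im z))) sqrrD.
by rewrite addrAC lerDl mulrn_wge0// mulr_ge0.
Qed.

Lemma normc_real r : normc r%:C = `|r|.
Proof. by rewrite normcE /= expr0n addr0 sqrtr_sqr. Qed.

Lemma real_complex_neq0 r : 0 < r -> r%:C != 0 :> R[i].
Proof. by move=> r0; rewrite -normc_eq0 normc_real normr_eq0 gt_eqF. Qed.

End ComplexAlgebra.

(** * Complex powers of a positive base *)

Section ComplexPower.
Context {R : realType}.
Implicit Types (r s t : R) (z w : R[i]).

Lemma normc_cpow t z : normc (cpow t z) = expR (Re z * ln t).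
Proof.
rewrite normcE /= !exprMn -mulrDr cos2Dsin2 mulr1 sqrtr_sqr ger0_norm//.
Qed.

Lemma cpow_neq0 t z : cpow t z != 0.
Proof. by rewrite -normc_eq0 normc_cpow expR_eq0. Qed.

Lemma cpowD t z w : cpow t (z + w) = cpow t z * cpow t w.
Proof.
apply: complex_ext; rewrite /= Re_add Im_add !mulrDl expRD ?cosD ?sinD; ring.
Qed.

Lemma cpow0 t : cpow t 0 = 1.
Proof. by rewrite /cpow /= !mul0r expR0 cos0 sin0 mulr1 mulr0. Qed.

Lemma cpowN t z : cpow t (- z) = (cpow t z)^-1.
Proof.
by apply: (mulfI (cpow_neq0 t z)); rewrite -cpowD subrr cpow0 divff ?cpow_neq0.
Qed.

Lemma cpowB t z w : cpow t (z - w) = cpow t z / cpow t w.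
Proof. by rewrite cpowD cpowN. Qed.

Lemma cpow_real t r : cpow t r%:C = (expR (r * ln t))%:C.
Proof. by rewrite /cpow /= mul0r cos0 sin0 mulr1 mulr0. Qed.

Lemma cpow1 t : 0 < t -> cpow t 1 = t%:C.
Proof. by move=> t0; rewrite cpow_real mul1r lnK. Qed.

Lemma cpowMl s t z : 0 < s -> 0 < t -> cpow (s * t) z = cpow s z * cpow t z.
Proof.
move=> s0 t0; apply: complex_ext => /=;
  rewrite lnM ?posrE// !mulrDr expRD ?cosD ?sinD; ring.
Qed.

Lemma cpow1l z : cpow 1 z = 1 :> R[i].
Proof. by rewrite /cpow ln1 !mulr0 expR0 cos0 sin0 mulr1 mulr0. Qed.

End ComplexPower.

(** * Derivatives of complex-valued functions of a real variable *)

Section ComplexDerivative.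
Context {R : realType}.
Implicit Types (r s t : R) (z w : R[i]) (f g : R -> R[i]).

(** A relational counterpart of [cderivable] and [cderive]: the value travels with the statement, so
    that the rules below compose into a raw expression that [is_cderive_eq] compares with the
    expected one at the end. *)
Definition is_cderive f t z :=
  is_derive t 1 (Re \o f) (Re z) /\ is_derive t 1 (Im \o f) (Im z).

Lemma is_cderive_eq f t z w : is_cderive f t z -> z = w -> is_cderive f t w.
Proof. by move=> h <-. Qed.

Lemma cderivable_is_cderive f t : cderivable f t -> is_cderive f t (cderive f t).
Proof.
case=> d1 d2; split; apply: DeriveDef.
- exact: d1.
- by rewrite [RHS]derive1E.
- exact: d2.
- by rewrite [RHS]derive1E.
Qed.

Lemma is_cderive_cderivable f t z : is_cderive f t z -> cderivable f t.
Proof. by case=> d1 d2; split; exact: ex_derive. Qed.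

Lemma is_cderive_cderive f t z : is_cderive f t z -> cderive f t = z.
Proof.
case=> d1 d2; apply: complex_ext; rewrite /= derive1E; exact: derive_val.
Qed.

Lemma near_eq_is_cderive f g t z : (\near t, f t = g t) ->
  is_cderive f t z -> is_cderive g t z.
Proof.
move=> fg [d1 d2]; split.
  apply: (near_eq_is_derive (f := Re \o f)) d1; rewrite ?oner_neq0//.
  by near=> x => /=; rewrite (near fg x).
apply: (near_eq_is_derive (f := Im \o f)) d2; rewrite ?oner_neq0//.
by near=> x => /=; rewrite (near fg x).
Unshelve. all: by end_near. Qed.

Lemma is_deriveD_fun (u v : R -> R) t du dv : is_derive t 1 u du ->
  is_derive t 1 v dv -> is_derive t 1 (fun s => u s + v s) (du + dv).
Proof. by move=> hu hv; exact: (@is_deriveD _ _ _ u v). Qed.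

Lemma is_deriveN_fun (u : R -> R) t du : is_derive t 1 u du ->
  is_derive t 1 (fun s => - u s) (- du).
Proof. by move=> hu; exact: (@is_deriveN _ _ _ u). Qed.

Lemma is_deriveM_fun (u v : R -> R) t du dv : is_derive t 1 u du ->
  is_derive t 1 v dv -> is_derive t 1 (fun s => u s * v s) (du * v t + u t * dv).
Proof.
move=> hu hv; apply: is_derive_eq (@is_deriveM _ _ u v t 1 du dv hu hv) _.
by rewrite /GRing.scale /= addrC mulrC.
Qed.

Lemma is_deriveZ_fun (u : R -> R) t du c : is_derive t 1 u du ->
  is_derive t 1 (fun s => c * u s) (c * du).
Proof. by move=> hu; exact: (@is_deriveZ _ _ _ u c). Qed.

Lemma is_derive_comp_fun (u v : R -> R) t du dv : is_derive (v t) 1 u du ->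
  is_derive t 1 v dv -> is_derive t 1 (fun s => u (v s)) (du * dv).
Proof. by move=> hu hv; exact: (@is_derive1_comp R u v). Qed.

Lemma is_derive_continuous (u : R -> R) t du : is_derive t 1 u du ->
  {for t, continuous u}.
Proof.
by move=> h; apply/differentiable_continuous/derivable1_diffP; exact: ex_derive.
Qed.

Lemma is_derive_sub (u : R -> R) t d d' : is_derive t 1 u d -> d = d' ->
  is_derive t 1 u d'.
Proof. by move=> h <-. Qed.

Lemma is_cderive_cst z t : is_cderive (fun=> z) t 0.
Proof. by split; apply: is_derive_cst. Qed.

Lemma is_cderive_real (u : R -> R) t du :
  is_derive t 1 u du -> is_cderive (fun s => (u s)%:C) t du%:C.
Proof. by move=> h; split => //=; exact: is_derive_cst. Qed.

Lemma is_cderiveD f g t z w : is_cderive f t z -> is_cderive g t w ->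
  is_cderive (fun s => f s + g s) t (z + w).
Proof.
move=> [f1 f2] [g1 g2]; split.
  under [X in is_derive _ _ X _]eq_fun do rewrite /= Re_add.
  by rewrite Re_add; exact: is_deriveD_fun.
under [X in is_derive _ _ X _]eq_fun do rewrite /= Im_add.
by rewrite Im_add; exact: is_deriveD_fun.
Qed.

Lemma is_cderiveM f g t z w : is_cderive f t z -> is_cderive g t w ->
  is_cderive (fun s => f s * g s) t (z * g t + f t * w).
Proof.
move=> [f1 f2] [g1 g2]; split.
  under [X in is_derive _ _ X _]eq_fun do rewrite /= Re_mul.
  apply: is_derive_sub (is_deriveD_fun (is_deriveM_fun f1 g1)
    (is_deriveN_fun (is_deriveM_fun f2 g2))) _.
  by rewrite !ReImE /=; ring.
under [X in is_derive _ _ X _]eq_fun do rewrite /= Im_mul.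
apply: is_derive_sub (is_deriveD_fun (is_deriveM_fun f1 g2)
  (is_deriveM_fun f2 g1)) _.
by rewrite !ReImE /=; ring.
Qed.

Lemma is_cderiveZ c f t z : is_cderive f t z -> is_cderive (fun s => c * f s) t (c * z).
Proof.
move=> h; apply: is_cderive_eq (is_cderiveM (is_cderive_cst c t) h) _.
by rewrite mul0r add0r.
Qed.

Lemma is_cderiveN f t z : is_cderive f t z -> is_cderive (fun s => - f s) t (- z).
Proof.
move=> h; have := is_cderiveZ (-1) h; rewrite mulN1r.
by under [X in is_cderive X]eq_fun do rewrite mulN1r.
Qed.

Lemma is_cderiveB f g t z w : is_cderive f t z -> is_cderive g t w ->
  is_cderive (fun s => f s - g s) t (z - w).
Proof. by move=> hf hg; apply: is_cderiveD => //; exact: is_cderiveN. Qed.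

Lemma is_deriveV_fun (u : R -> R) t du : u t != 0 -> is_derive t 1 u du ->
  is_derive t 1 (fun s => (u s)^-1) (- (u t) ^- 2 * du).
Proof.
move=> ut0 [u1 <-]; apply: DeriveDef; first exact: derivableV.
by rewrite deriveV.
Qed.

Lemma is_cderiveV f t z : f t != 0 -> is_cderive f t z ->
  is_cderive (fun s => (f s)^-1) t (- (z / (f t * f t))).
Proof.
move=> ft0 [f1 f2].
have n0 : Re (f t) * Re (f t) + Im (f t) * Im (f t) != 0.
  by rewrite -!expr2 -sqr_normc_ReIm sqrf_eq0 normc_eq0.
have dn := is_deriveD_fun (is_deriveM_fun f1 f1) (is_deriveM_fun f2 f2).
have dv := is_deriveV_fun (u := fun s => Re (f s) * Re (f s) + Im (f s) * Im (f s)) n0 dn.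
split.
  under [X in is_derive _ _ X _]eq_fun do rewrite /= Re_inv !expr2.
  apply: is_derive_sub (is_deriveM_fun f1 dv) _.
  rewrite /= !ReImE Re_inv Im_inv !ReImE /=.
  move: n0; set x := Re (f t); set y := Im (f t) => n0.
  (* The remaining denominator is the squared modulus of [f t * f t], written in [x] and [y]; it
     equals [(x * x + y * y) ^+ 2]. *)
  by field; rewrite n0 (_ : _ + _ = (x * x + y * y) ^+ 2) ?expf_neq0//; ring.
under [X in is_derive _ _ X _]eq_fun do rewrite /= Im_inv !expr2.
apply: is_derive_sub (is_deriveN_fun (is_deriveM_fun f2 dv)) _.
rewrite /= !ReImE Re_inv Im_inv !ReImE /=.
move: n0; set x := Re (f t); set y := Im (f t) => n0.
by field; rewrite n0 (_ : _ + _ = (x * x + y * y) ^+ 2) ?expf_neq0//; ring.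
Qed.

Lemma is_derive_lnM (u : R -> R) t du c : 0 < u t -> is_derive t 1 u du ->
  is_derive t 1 (fun s => c * ln (u s)) (c * (du / u t)).
Proof.
move=> ut0 hu; apply: is_deriveZ_fun.
rewrite mulrC; exact: is_derive_comp_fun (is_derive1_ln ut0) hu.
Qed.

Lemma is_cderive_cpow (u : R -> R) t du z : 0 < u t -> is_derive t 1 u du ->
  is_cderive (fun s => cpow (u s) z) t (z * du%:C / (u t)%:C * cpow (u t) z).
Proof.
move=> ut0 hu.
have hk c := is_derive_lnM c ut0 hu.
have he := is_derive_comp_fun (is_derive_expR _) (hk (Re z)).
have hc := is_derive_comp_fun (is_derive_cos _) (hk (Im z)).
have hs := is_derive_comp_fun (is_derive_sin _) (hk (Im z)).
have u0 : u t != 0 by rewrite gt_eqF.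
split.
  apply: is_derive_sub (is_deriveM_fun he hc) _.
  by rewrite !ReImE Re_inv Im_inv /=; field.
apply: is_derive_sub (is_deriveM_fun he hs) _.
by rewrite !ReImE Re_inv Im_inv /=; field.
Qed.

End ComplexDerivative.

(** * The fundamental theorem of calculus on the positive half-line *)

Section HalfLineFTC.
Context {R : realType}.
Local Notation mu := (@lebesgue_measure R).
Implicit Types (f F : R -> R).

Lemma gt0_itvP (x : R) : (`]0, +oo[%classic : set R) x <-> 0 < x.
Proof. by rewrite /= in_itv/= andbT. Qed.

(** The shift by two puts the endpoints strictly on either side of 1, so that already the segment of
    index 0 has the positive length that [FTC_segment] asks for. *)
Definition half_line_exhaustion (n : nat) : set R := `[n.+2%:R^-1, n.+2%:R].

Lemma half_line_exhaustion_gt0 n x : half_line_exhaustion n x -> 0 < x.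
Proof.
by rewrite /half_line_exhaustion /= in_itv/= => /andP[+ _]; apply: lt_le_trans; rewrite invr_gt0.
Qed.

Lemma half_line_exhaustion_nd : nondecreasing_seq half_line_exhaustion.
Proof.
apply/nondecreasing_seqP => n; apply/subsetPset => x.
rewrite /half_line_exhaustion /= !in_itv/= => /andP[h1 h2]; apply/andP; split.
  by apply: le_trans h1; rewrite lef_pV2 ?posrE// ler_nat.
by apply: le_trans h2 _; rewrite ler_nat.
Qed.

Lemma near_half_line_exhaustion x : 0 < x -> \forall n \near \oo, half_line_exhaustion n x.
Proof.
move=> x0; near=> n.
rewrite /half_line_exhaustion /= in_itv/=; apply/andP; split.
  rewrite -[x]invrK lef_pV2 ?posrE ?invr_gt0//.
  apply: (@le_trans _ _ n%:R); last by rewrite ler_nat -addn2 leq_addr.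
  by near: n; exact: nbhs_infty_ger.
apply: (@le_trans _ _ n%:R); last by rewrite ler_nat -addn2 leq_addr.
by near: n; exact: nbhs_infty_ger.
Unshelve. all: by end_near. Qed.

Lemma bigcup_half_line_exhaustion :
  \bigcup_n half_line_exhaustion n = `]0, +oo[%classic.
Proof.
apply/seteqP; split => x /=.
  by move=> [n _] /half_line_exhaustion_gt0; rewrite in_itv/= andbT.
rewrite in_itv/= andbT => /near_half_line_exhaustion [N _ h].
by exists N => //; apply: h => /=.
Qed.

Section FTC.
Variables (f F : R -> R).
Hypothesis mf : measurable_fun setT f.
Hypothesis dF : forall x : R, 0 < x -> is_derive x 1 F (f x).
Hypothesis cf : forall x : R, 0 < x -> {for x, continuous f}.

Lemma FTC_segment a b : 0 < a -> a < b ->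
  (\int[mu]_(x in `[a, b]) (f x)%:E = (F b - F a)%:E)%E.
Proof.
move=> a0 ab.
have cF x : 0 < x -> {for x, continuous F}.
  by move=> /dF; exact: is_derive_continuous.
rewrite EFinB; apply: continuous_FTC2 => //.
- apply: continuous_in_subspaceT => x.
  by rewrite inE/= in_itv/= => /andP[ax _]; apply: cf; exact: lt_le_trans ax.
- split.
  + move=> x; rewrite in_itv/= => /andP[ax _].
    by apply: ex_derive; apply: dF; exact: lt_trans ax.
  + by apply: cvg_at_right_filter; exact: cF.
  + by apply: cvg_at_left_filter; apply: cF; exact: lt_trans ab.
- move=> x; rewrite in_itv/= => /andP[ax _].
  have := dF (lt_trans a0 ax) => h.
  by rewrite derive1E derive_val.
Qed.

(** Monotone convergence along the exhaustion: the integral over each segment is a difference of two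
    values of [F], hence at most [B]. No limit of [F] has to be computed. *)
Lemma ge0_FTC_integrable (B : R) : (forall x, 0 < x -> 0 <= f x) ->
  (forall x, 0 < x -> 0 <= F x <= B) ->
  mu.-integrable `]0, +oo[ (EFin \o f).
Proof.
move=> f0 FB; apply/integrableP; split.
  by apply/measurable_EFinP; exact: measurable_funTS.
rewrite (@le_lt_trans _ _ B%:E) ?ltry//.
rewrite -bigcup_half_line_exhaustion.
apply: (cvge_to_le (@ge0_nondecreasing_set_cvg_integral _ _ _ _ _ mu _ _ _ _)).
- exact: half_line_exhaustion_nd.
- by move=> n; exact: measurable_itv.
- move=> n; apply: measurableT_comp => //.
  by apply/measurable_EFinP; exact: measurable_funTS.
- by move=> n x _; exact: abse_ge0.
near=> n.
rewrite [leLHS](_ : _ = (\int[mu]_(x in half_line_exhaustion n) (f x)%:E)%E); last first.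
  apply: eq_integral => x; rewrite inE => /half_line_exhaustion_gt0 x0 /=.
  by rewrite ger0_norm// f0.
rewrite FTC_segment ?invr_gt0//; last first.
  by rewrite (@lt_trans _ _ 1)// ?invf_lt1 ?ltr1n.
have /andP[_ h1] := FB n.+2%:R (ltr0Sn _ _).
have /andP[h2 _] : 0 <= F n.+2%:R^-1 <= B by apply: FB; rewrite invr_gt0.
by rewrite lee_fin; lra.
Unshelve. all: by end_near. Qed.

(** Dominated convergence for the restrictions of [f] to the segments of the exhaustion, with [|f|]
    itself as majorant; hence limits of [F] along the two sequences of endpoints suffice. *)
Lemma FTC_half_line (A B : R) : mu.-integrable `]0, +oo[ (EFin \o f) ->
  F n.+2%:R^-1 @[n --> \oo] --> A -> F n.+2%:R @[n --> \oo] --> B ->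
  \int[mu]_(x in `]0, +oo[) f x = B - A.
Proof.
move=> fint FA FB.
have mD : measurable (`]0, +oo[%classic : set R) by exact: measurable_itv.
have := @dominated_convergence _ _ _ mu _ mD
  (fun n => (EFin \o f) \_ (half_line_exhaustion n)) (EFin \o f) (abse \o (EFin \o f)).
case.
- move=> n; apply/measurable_restrict => //; first exact: measurable_itv.
  by apply/measurable_EFinP; exact: measurable_funTS.
- by apply/measurable_EFinP; exact: measurable_funTS.
- apply: aeW => x; rewrite /= in_itv/= andbT => /near_half_line_exhaustion Jx.
  apply: cvg_near_cst; near=> n.
  by rewrite patchE mem_set//; near: n.
- exact: integrable_abse.
- apply: aeW => x n _; rewrite patchE; case: ifPn => //= _.
  by rewrite normr0 lee_fin.
have -> : (\int[mu]_(x in `]0%R, +oo[) (EFin \o f) x)%E =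
    (\int[mu]_(x in `]0, +oo[) f x)%:E.
  by rewrite fineK//; exact: integrable_fin_num.
move=> _ _ /fine_cvg h.
move/cvg_lim : h => <- //; apply: cvg_lim => //.
apply: cvg_trans (cvgB FB FA).
apply: near_eq_cvg; near=> n => /=.
rewrite -integral_mkcondr setIidr; last first.
  by move=> x /half_line_exhaustion_gt0; rewrite /= in_itv/= andbT.
rewrite FTC_segment ?invr_gt0//.
by rewrite (@lt_trans _ _ 1)// ?invf_lt1 ?ltr1n.
Unshelve. all: by end_near. Qed.

End FTC.
End HalfLineFTC.

(** * Measurability and integration of complex-valued functions *)

Section ComplexMeasurable.
Context {R : realType} d {T : measurableType d}.
Implicit Types (f g : T -> R[i]) (u : T -> R).

(** The domain is an arbitrary measurable type because the final exchange of integrals needs joint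
    measurability on [R * R]. *)
Definition cmeasurable f :=
  measurable_fun setT (Re \o f) /\ measurable_fun setT (Im \o f).

Lemma cmeasurable_cst z : cmeasurable (fun=> z).
Proof. by split; exact: measurable_cst. Qed.

Lemma cmeasurable_real u : measurable_fun setT u -> cmeasurable (fun x => (u x)%:C).
Proof. by split => //; exact: measurable_cst. Qed.

Lemma cmeasurableM f g : cmeasurable f -> cmeasurable g ->
  cmeasurable (fun x => f x * g x).
Proof.
move=> [f1 f2] [g1 g2]; split.
  rewrite (_ : _ \o _ = ((Re \o f) \* (Re \o g)) \- ((Im \o f) \* (Im \o g))).
    by apply: measurable_funB; exact: measurable_funM.
  by apply/funext => x /=; rewrite Re_mul.
rewrite (_ : _ \o _ = ((Re \o f) \* (Im \o g)) \+ ((Im \o f) \* (Re \o g))).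
  by apply: measurable_funD; exact: measurable_funM.
by apply/funext => x /=; rewrite Im_mul.
Qed.

Lemma cmeasurableD f g : cmeasurable f -> cmeasurable g ->
  cmeasurable (fun x => f x + g x).
Proof.
move=> [f1 f2] [g1 g2]; split.
  rewrite (_ : _ \o _ = (Re \o f) \+ (Re \o g)); first exact: measurable_funD.
  by apply/funext => x /=; rewrite Re_add.
rewrite (_ : _ \o _ = (Im \o f) \+ (Im \o g)); first exact: measurable_funD.
by apply/funext => x /=; rewrite Im_add.
Qed.

Lemma cmeasurable_cpow u z : measurable_fun setT u ->
  cmeasurable (fun x => cpow (u x) z).
Proof.
move=> mu.
have ml c : measurable_fun setT (fun x => c * ln (u x)).
  apply: measurable_funM; first exact: measurable_cst.
  by apply: measurableT_comp => //; exact: measurable_ln.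
have me : measurable_fun setT (fun x => expR (Re z * ln (u x))).
  by apply: measurableT_comp => //; exact: measurable_expR.
have mc : measurable_fun setT (fun x => cos (Im z * ln (u x))).
  apply: measurableT_comp => //; apply: continuous_measurable_fun.
  exact: continuous_cos.
have ms : measurable_fun setT (fun x => sin (Im z * ln (u x))).
  apply: measurableT_comp => //; apply: continuous_measurable_fun.
  exact: continuous_sin.
by split; exact: measurable_funM.
Qed.

End ComplexMeasurable.

Section ComplexIntegral.
Context {R : realType}.
Local Notation mu := (@lebesgue_measure R).
Implicit Types (D : set R) (f g : R -> R[i]) (z : R[i]).

Lemma eq_cintegrable D f g : measurable D -> (forall x, D x -> f x = g x) ->
  cintegrable D f -> cintegrable D g.
Proof.
move=> mD fg [f1 f2]; split; [move: f1|move: f2]; apply: eq_integrable => // x;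
  by rewrite inE => Dx; rewrite fg.
Qed.

Lemma eq_cintegral D f g : (forall x, D x -> f x = g x) ->
  cintegral D f = cintegral D g.
Proof.
by move=> fg; rewrite /cintegral; congr (_ +i* _);
  apply: eq_Rintegral => x; rewrite inE => Dx; rewrite fg.
Qed.

Lemma le_cintegrable D f (g : R -> R) : measurable D -> cmeasurable f ->
  mu.-integrable D (EFin \o g) -> (forall x, D x -> normc (f x) <= g x) ->
  cintegrable D f.
Proof.
move=> mD [m1 m2] ig fg; split; apply: le_integrable ig => //.
- by apply/measurable_EFinP; apply: measurable_funTS; exact: m1.
- move=> x Dx /=; rewrite lee_fin (le_trans (normr_Re_le _))//.
  by rewrite (le_trans (fg _ Dx))// ler_norm.
- by apply/measurable_EFinP; apply: measurable_funTS; exact: m2.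
- move=> x Dx /=; rewrite lee_fin (le_trans (normr_Im_le _))//.
  by rewrite (le_trans (fg _ Dx))// ler_norm.
Qed.

Lemma cintegrableD D f g : measurable D -> cintegrable D f -> cintegrable D g ->
  cintegrable D (fun x => f x + g x).
Proof.
move=> mD [f1 f2] [g1 g2]; split.
  by under eq_fun do rewrite Re_add EFinD; exact: integrableD.
by under eq_fun do rewrite Im_add EFinD; exact: integrableD.
Qed.

Lemma cintegralD D f g : measurable D -> cintegrable D f -> cintegrable D g ->
  cintegral D (fun x => f x + g x) = cintegral D f + cintegral D g.
Proof.
move=> mD [f1 f2] [g1 g2]; rewrite /cintegral; apply: complex_ext => /=.
  by under [LHS]eq_Rintegral do rewrite Re_add; rewrite RintegralD.
by under [LHS]eq_Rintegral do rewrite Im_add; rewrite RintegralD.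
Qed.

Lemma integrable_EFinZl D (u : R -> R) c : measurable D ->
  mu.-integrable D (fun x => (u x)%:E) -> mu.-integrable D (fun x => (c * u x)%:E).
Proof. by move=> mD iu; under eq_fun do rewrite EFinM; exact: integrableZl. Qed.

Lemma cintegrableZ D f z : measurable D -> cintegrable D f ->
  cintegrable D (fun x => z * f x).
Proof.
move=> mD [f1 f2]; split.
  under eq_fun do rewrite Re_mul EFinB.
  by apply: integrableB => //; exact: integrable_EFinZl.
under eq_fun do rewrite Im_mul EFinD.
by apply: integrableD => //; exact: integrable_EFinZl.
Qed.

Lemma cintegralZ D f z : measurable D -> cintegrable D f ->
  cintegral D (fun x => z * f x) = z * cintegral D f.
Proof.
move=> mD [f1 f2]; apply: complex_ext => /=.
  rewrite Re_mul; under [LHS]eq_Rintegral do rewrite Re_mul.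
  by rewrite RintegralB ?RintegralZl//; exact: integrable_EFinZl.
rewrite Im_mul; under [LHS]eq_Rintegral do rewrite Im_mul.
by rewrite RintegralD ?RintegralZl//; exact: integrable_EFinZl.
Qed.

End ComplexIntegral.

(** * Integrable majorants built from powers and exponentials *)

Section Kernels.
Context {R : realType}.
Local Notation mu := (@lebesgue_measure R).

(** The tangent bound [ln y <= y - 1] at [y = e * (1 + s)], multiplied by [n]: the choice
    [e = c / n] makes the slope exactly [c]. Adding 1 to [|q|] keeps [n] positive when [q = 0]. *)
Lemma ln1D_linear_bound (q c : R) : 0 < c ->
  exists K, forall s, 0 < s -> q * ln (1 + s) <= c * s + K.
Proof.
move=> c0; pose n := `|q| + 1; pose e := c / n.
have n0 : 0 < n by rewrite ltr_wpDl.
have e0 : 0 < e by rewrite divr_gt0.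
exists (c - n * (1 + ln e)) => s s0.
have s1 : 0 < 1 + s by rewrite addr_gt0.
have l0 : 0 <= ln (1 + s) by rewrite ln_ge0// lerDl ltW.
have h : ln (e * (1 + s)) <= e * (1 + s) - 1.
  rewrite -{1}[e * _](subrK 1) addrC le_ln1Dx//.
  by rewrite ltrBrDl addrN mulr_gt0.
rewrite lnM ?posrE// in h.
apply: (@le_trans _ _ (n * ln (1 + s))).
  by rewrite ler_wpM2r// (le_trans (ler_norm q))// lerDl.
have -> : c * s + (c - n * (1 + ln e)) = n * (e * (1 + s) - 1 - ln e).
  by rewrite /e; field; rewrite gt_eqF.
by rewrite ler_pM2l//; lra.
Qed.

(** Trades the exponential for a power decay of any chosen order [r], the behaviour at 0 being kept.
    With [r] equal to the exponent at 0 plus 2, the right-hand side has an elementary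
    antiderivative. *)
Lemma kernel_bound (c p q r : R) : 0 < c ->
  exists2 K, 0 < K & forall s, 0 < s ->
  expR (p * ln s + q * ln (1 + s) - c * s) <=
    K * expR (p * ln s - r * ln (1 + s)).
Proof.
move=> c0; have [K hK] := ln1D_linear_bound (q + r) c0.
exists (expR K); rewrite ?expR_gt0// => s s0.
rewrite -expRD ler_expR.
by have := hK _ s0; rewrite mulrDl; lra.
Qed.

Lemma measurable_ln_kernel (p q c : R) :
  measurable_fun setT (fun s => expR (p * ln s + q * ln (1 + s) - c * s)).
Proof.
have ml c' : measurable_fun setT (fun s : R => c' * s).
  by apply: measurable_funM; [exact: measurable_cst|exact: measurable_id].
have ms : measurable_fun setT (fun s : R => 1 + s).
  by apply: measurable_funD; [exact: measurable_cst|exact: measurable_id].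
have mln : measurable_fun setT (fun s : R => q * ln (1 + s)).
  apply: measurable_funM; first exact: measurable_cst.
  exact: measurableT_comp (@measurable_ln R) ms.
have mlp : measurable_fun setT (fun s : R => p * ln s).
  apply: measurable_funM; first exact: measurable_cst.
  exact: measurable_ln.
apply: measurableT_comp; first exact: measurable_expR.
by apply: measurable_funB; [exact: measurable_funD|exact: ml].
Qed.

(** The function [s^(p-1) (1+s)^(-p-1)] is the derivative of [(s / (1 + s))^p / p], which stays
    between 0 and [1 / p]. *)
Lemma integrable_beta_kernel (p : R) : 0 < p ->
  mu.-integrable `]0, +oo[
    (EFin \o (fun s => expR ((p - 1) * ln s - (p + 1) * ln (1 + s)))).
Proof.
move=> p0.
have d1 (t : R) : 0 < t -> is_derive t 1 (fun s : R => 1 + s) (0 + 1).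
  by move=> t0; apply: is_deriveD_fun; exact: is_derive_cst.
have d2 c e (t : R) : 0 < t -> is_derive t 1 (fun s : R => c * ln s + e * ln (1 + s))
    (c * (1 / t) + e * ((0 + 1) / (1 + t))).
  move=> t0; apply: is_deriveD_fun.
    exact: (is_derive_lnM (u := id)).
  apply: (is_derive_lnM (u := fun s => 1 + s)).
    by rewrite addr_gt0.
apply: (@ge0_FTC_integrable _ (fun s => expR ((p - 1) * ln s - (p + 1) * ln (1 + s)))
    (fun s => p^-1 * expR (p * ln s + (- p) * ln (1 + s)))
    _ _ _ p^-1).
- have := measurable_ln_kernel (p - 1) (- (p + 1)) 0.
  by under eq_fun do rewrite mul0r subr0 mulNr.
- move=> t t0; have t1 : 0 < 1 + t by rewrite addr_gt0.
  apply: is_derive_sub (is_deriveZ_fun _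
    (is_derive_comp_fun (is_derive_expR _) (d2 p (- p) _ t0))) _.
  rewrite [RHS](_ : _ = expR (p * ln t + (- p) * ln (1 + t) + (- ln t - ln (1 + t)))); last first.
    by congr expR; ring.
  rewrite [in RHS]expRD [expR (- ln t - _)]expRB expRN !lnK ?posrE//.
  by field; rewrite !gt_eqF.
- move=> t t0; have := is_derive_comp_fun (is_derive_expR _) (d2 (p - 1) (- (p + 1)) _ t0).
  by under [X in is_derive _ _ X _]eq_fun do rewrite mulNr; exact: is_derive_continuous.
- by move=> t t0; exact: expR_ge0.
- move=> t t0; rewrite mulr_ge0 ?invr_ge0 ?expR_ge0 ?(ltW p0)//=.
  rewrite -[leRHS]mulr1 ler_pM2l ?invr_gt0// expR_le1 mulNr subr_le0 ler_pM2l//.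
  by rewrite ler_ln ?posrE ?addr_gt0// lerDr.
Qed.

Lemma integrable_ln_kernel (p q c : R) : 0 < p -> 0 < c ->
  mu.-integrable `]0, +oo[
    (EFin \o (fun s => expR ((p - 1) * ln s + q * ln (1 + s) - c * s))).
Proof.
move=> p0 c0; have [K K0 hK] := kernel_bound (p - 1) q (p + 1) c0.
have := integrable_EFinZl K (measurable_itv _) (integrable_beta_kernel p0).
apply: le_integrable => //.
  by apply/measurable_EFinP/measurable_funTS; exact: measurable_ln_kernel.
move=> s /=; rewrite in_itv/= andbT => s0.
by rewrite lee_fin ger0_norm ?expR_ge0// (le_trans (hK _ s0))// ler_norm.
Qed.

End Kernels.

(** * Differentiation of Laplace transforms *)

Section RealLaplace.
Context {R : realType}.
Local Notation mu := (@lebesgue_measure R).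
Variable h : R -> R.
Hypothesis mh : measurable_fun setT h.
Hypothesis ih : forall c : R, 0 < c ->
  mu.-integrable `]0, +oo[ (EFin \o (fun s : R => expR (- (c * s)) * h s)).

(** Half of the decay rate pays for the factor [s]: this is [y <= e^y] at [y = c s / 2]. *)
Lemma mulX_expR_le (c s : R) : 0 < c -> 0 < s ->
  s * expR (- (c * s)) <= 2 / c * expR (- (c / 2 * s)).
Proof.
move=> c0 s0.
have -> : - (c * s) = - (c / 2 * s) + - (c / 2 * s) by field.
rewrite expRD mulrA ler_pM2r ?expR_gt0// expRN ler_pdivrMr ?expR_gt0//.
have h1 := expR_ge1Dx (c / 2 * s).
apply: (@le_trans _ _ (2 / c * (c / 2 * s))).
  by rewrite le_eqVlt; apply/orP; left; apply/eqP; field; rewrite gt_eqF.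
by rewrite ler_pM2l ?divr_gt0//; lra.
Qed.

Let measurable_expM c : measurable_fun setT (fun s : R => expR (- (c * s))).
Proof.
apply: measurableT_comp; first exact: measurable_expR.
exact: measurableT_comp.
Qed.

Lemma laplace_integrableX (c : R) : 0 < c ->
  mu.-integrable `]0, +oo[ (EFin \o (fun s => expR (- (c * s)) * (s * h s))).
Proof.
move=> c0; have c20 : 0 < c / 2 by rewrite divr_gt0.
have := integrable_EFinZl (2 / c) (measurable_itv _) (ih c20).
apply: le_integrable => //.
  apply/measurable_EFinP/measurable_funTS.
  apply: measurable_funM; first exact: measurable_expM.
  by apply: measurable_funM; [exact: measurable_id|exact: mh].
move=> s /=; rewrite in_itv/= andbT => s0.
rewrite lee_fin [_ * (s * _)]mulrCA !mulrA !(normrM _ (h s)) ler_wpM2r//.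
rewrite !ger0_norm ?mulr_ge0 ?expR_ge0 ?(ltW s0) ?invr_ge0 ?(ltW c0)//.
exact: mulX_expR_le.
Qed.

Lemma is_derive_laplace (t : R) : 0 < t ->
  is_derive t 1 (fun u => \int[mu]_(s in `]0, +oo[) (expR (- (u * s)) * h s))
    (- \int[mu]_(s in `]0, +oo[) (expR (- (t * s)) * (s * h s))).
Proof.
move=> t0.
pose f (u s : R) : R := expR (- (u * s)) * h s.
have df (u s : R) : is_derive u 1 (f ^~ s) (- (expR (- (u * s)) * (s * h s))).
  have d1 : is_derive u 1 (fun x : R => - (x * s)) (- (1 * s + u * 0)).
    apply: is_deriveN_fun; apply: is_deriveM_fun.
  have := is_deriveM_fun (is_derive_comp_fun (is_derive_expR _) d1)
     (is_derive_cst (h s) u 1).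
  move/is_derive_sub; apply; rewrite /=; ring.
have t20 : 0 < t / 2 by rewrite divr_gt0.
have It : `]t / 2, t + 1[%classic t by rewrite /= in_itv/=; apply/andP; split; lra.
have If (u : R) : `]t / 2, t + 1[%classic u -> 0 < u.
  by rewrite /= in_itv/= => /andP[+ _]; exact: lt_trans.
(* For [u > t / 2] the exponential is at most [e^(- t s / 2)]; absorbing the factor [s] brought down
   by the derivative halves the rate again, to [t / 4]. *)
pose G (s : R) : R := 2 / (t / 2) * (expR (- (t / 2 / 2 * s)) * `|h s|).
have G0 (s : R) : 0 <= G s by rewrite mulr_ge0 ?divr_ge0 ?mulr_ge0 ?expR_ge0 ?(ltW t0)//.
have iG : mu.-integrable `]0, +oo[ (EFin \o G).
  apply: integrable_EFinZl => //.
  have t40 : 0 < t / 2 / 2 by rewrite divr_gt0.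
  have := integrable_abse (ih t40).
  by apply: eq_integrable => // s _ /=; rewrite normrM [`|expR _|]ger0_norm ?expR_ge0.
have Gub (u s : R) : `]t / 2, t + 1[%classic u -> `]0, +oo[%classic s ->
    `|partial1of2 f u s| <= G s.
  rewrite /= !in_itv/= andbT => /andP[tu _] s0.
  rewrite partial1of2E (@derive_val _ _ _ _ _ _ _ (df u s)) normrN /G.
  rewrite [_ * (s * _)]mulrCA !mulrA (normrM _ (h s)) ler_wpM2r//.
  rewrite ger0_norm ?mulr_ge0 ?expR_ge0 ?(ltW s0)//.
  apply: le_trans (mulX_expR_le t20 s0).
  by rewrite ler_pM2l// ler_expR lerN2 ler_pM2r// ltW.
have derf (u s : R) : `]t / 2, t + 1[%classic u -> `]0, +oo[%classic s ->
    derivable (f ^~ s) u 1.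
  by move=> _ _; apply: ex_derive; exact: df.
have mD : measurable (`]0, +oo[%classic : set R) by exact: measurable_itv.
have intf (u : R) : `]t / 2, t + 1[%classic u ->
    mu.-integrable `]0, +oo[ (EFin \o f u) by move=> /If; exact: ih.
apply: DeriveDef.
  exact: (@derivable_under_integral _ _ _ mu f _ mD t _ _ It intf derf G G0 iG Gub).
rewrite -derive1E (@differentiation_under_integral _ _ _ mu f _ mD t _ _ It intf derf G G0 iG Gub).
rewrite -[RHS]mulN1r -RintegralZl//; last exact: laplace_integrableX.
apply: eq_Rintegral => s _.
by rewrite partial1of2E (@derive_val _ _ _ _ _ _ _ (df t s)) mulN1r.
Qed.

End RealLaplace.

Section ComplexLaplace.
Context {R : realType}.
Implicit Types (h : R -> R[i]).

Lemma Re_real_mul (r : R) (z : R[i]) : Re (r%:C * z) = r * Re z.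
Proof. by rewrite Re_mul /= mul0r subr0. Qed.

Lemma Im_real_mul (r : R) (z : R[i]) : Im (r%:C * z) = r * Im z.
Proof. by rewrite Im_mul /= mul0r addr0. Qed.

Lemma cintegrable_real_mul (D : set R) (u : R -> R) h :
  cintegrable D (fun s => (u s)%:C * h s) <->
  (@lebesgue_measure R).-integrable D (EFin \o (fun s => u s * Re (h s))) /\
  (@lebesgue_measure R).-integrable D (EFin \o (fun s => u s * Im (h s))).
Proof.
rewrite /cintegrable.
rewrite (_ : (fun t => (Re _)%:E) = EFin \o (fun s => u s * Re (h s))); last first.
  by apply/funext => s /=; rewrite Re_real_mul.
rewrite (_ : (fun t => (Im _)%:E) = EFin \o (fun s => u s * Im (h s)))//.
by apply/funext => s /=; rewrite Im_real_mul.
Qed.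

Definition claplace h (t : R) : R[i] :=
  cintegral `]0, +oo[ (fun s => (expR (- (t * s)))%:C * h s).

(** Convergence is required at every positive rate since each multiplication by [s] spends half of
    the available rate; the class is thereby stable under differentiation of the transform. *)
Definition claplaceable h := cmeasurable h /\
  (forall c : R, 0 < c -> cintegrable `]0, +oo[ (fun s => (expR (- (c * s)))%:C * h s)).

Lemma claplaceE h t : claplace h t =
  (\int[@lebesgue_measure R]_(s in `]0, +oo[) (expR (- (t * s)) * Re (h s))) +i*
  (\int[@lebesgue_measure R]_(s in `]0, +oo[) (expR (- (t * s)) * Im (h s))).
Proof.
rewrite /claplace /cintegral; congr (_ +i* _).
  by under [LHS]eq_Rintegral do rewrite Re_real_mul.
by under [LHS]eq_Rintegral do rewrite Im_real_mul.
Qed.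

Lemma claplaceableX h : claplaceable h -> claplaceable (fun s => s%:C * h s).
Proof.
move=> [[m1 m2] ih]; split.
  by apply: cmeasurableM => //; apply: cmeasurable_real; exact: measurable_id.
move=> c c0; apply/cintegrable_real_mul.
rewrite (_ : (fun s => _ * Re _) = (fun s => expR (- (c * s)) * (s * Re (h s)))); last first.
  by apply/funext => s; rewrite Re_real_mul.
rewrite (_ : (fun s => _ * Im _) = (fun s => expR (- (c * s)) * (s * Im (h s)))); last first.
  by apply/funext => s; rewrite Im_real_mul.
split.
  apply: (laplace_integrableX (h := Re \o h) m1) => // e e0.
  by have /cintegrable_real_mul[] := ih _ e0.
apply: (laplace_integrableX (h := Im \o h) m2) => // e e0.
by have /cintegrable_real_mul[] := ih _ e0.
Qed.

Lemma is_cderive_claplace h (t : R) : claplaceable h -> 0 < t ->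
  is_cderive (claplace h) t (- claplace (fun s => s%:C * h s) t).
Proof.
move=> [[m1 m2] ih] t0.
rewrite (_ : claplace h = fun u =>
    (\int[@lebesgue_measure R]_(s in `]0, +oo[) (expR (- (u * s)) * Re (h s))) +i*
    (\int[@lebesgue_measure R]_(s in `]0, +oo[) (expR (- (u * s)) * Im (h s)))); last first.
  by apply/funext => u; exact: claplaceE.
split; rewrite ?Re_opp ?Im_opp claplaceE /=.
  under [X in - X]eq_Rintegral do rewrite Re_real_mul.
  apply: (is_derive_laplace (h := Re \o h) m1) => // e e0.
  by have /cintegrable_real_mul[] := ih _ e0.
under [X in - X]eq_Rintegral do rewrite Im_real_mul.
apply: (is_derive_laplace (h := Im \o h) m2) => // e e0.
by have /cintegrable_real_mul[] := ih _ e0.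
Qed.

End ComplexLaplace.

(** * Integrals of total derivatives *)

Section ComplexFTC.
Context {R : realType}.
Local Notation mu := (@lebesgue_measure R).

Lemma is_cderive_continuous (f : R -> R[i]) (t : R) z : is_cderive f t z ->
  {for t, continuous (Re \o f)} /\ {for t, continuous (Im \o f)}.
Proof. by move=> [d1 d2]; split; apply: is_derive_continuous; eassumption. Qed.

Lemma cvg_norm_le0 (u : R^nat) (v : R^nat) :
  v n @[n --> \oo] --> (0 : R) -> (forall n, `|u n| <= v n) ->
  u n @[n --> \oo] --> (0 : R).
Proof.
move=> v0 uv; apply/cvgrPdist_lt => e e0.
move/cvgrPdist_lt : v0 => /(_ e e0); apply: filterS => n.
rewrite !sub0r !normrN => h.
exact: le_lt_trans (uv n) (le_lt_trans (ler_norm _) h).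
Qed.

(** [FTC_half_line] on real and imaginary parts, with vanishing boundary terms. Differentiability of
    [g] supplies the continuity required there and comes directly from the product rules. *)
Lemma cintegral_derive0 (G g : R -> R[i]) : cmeasurable g ->
  cintegrable `]0, +oo[ g ->
  (forall x : R, 0 < x -> is_cderive G x (g x)) ->
  (forall x : R, 0 < x -> exists z, is_cderive g x z) ->
  normc (G n.+2%:R^-1) @[n --> \oo] --> (0 : R) ->
  normc (G n.+2%:R) @[n --> \oo] --> (0 : R) ->
  cintegral `]0, +oo[ g = 0.
Proof.
move=> [m1 m2] [i1 i2] dG dg G0 Goo; apply: complex_ext => /=.
  rewrite (@FTC_half_line _ (Re \o g) (Re \o G) m1 _ _ 0 0) ?subrr//.
  - by move=> x x0; case: (dG x x0).
  - by move=> x /dg[z] /is_cderive_continuous[].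
  - by apply: (cvg_norm_le0 G0) => n; exact: normr_Re_le.
  - by apply: (cvg_norm_le0 Goo) => n; exact: normr_Re_le.
rewrite (@FTC_half_line _ (Im \o g) (Im \o G) m2 _ _ 0 0) ?subrr//.
- by move=> x x0; case: (dG x x0).
- by move=> x /dg[z] /is_cderive_continuous[].
- by apply: (cvg_norm_le0 G0) => n; exact: normr_Im_le.
- by apply: (cvg_norm_le0 Goo) => n; exact: normr_Im_le.
Qed.

Lemma cvg_expR_ln0 (p : R) : 0 < p -> expR (- (p * ln n.+2%:R)) @[n --> \oo] --> (0 : R).
Proof.
move=> p0; have : p * ln (n.+2%:R : R) @[n --> \oo] --> +oo.
  apply/cvgryPge => A; near=> n.
  rewrite mulrC -ler_pdivrMr// -ler_expR lnK ?posrE//.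
  apply: (@le_trans _ _ n%:R); last by rewrite ler_nat -addn2 leq_addr.
  by near: n; exact: nbhs_infty_ger.
by have /cvg_pinftyP := @cvgr_expR R; apply.
Unshelve. all: by end_near. Qed.

Lemma cvg_mul_expR_ln0 (K p : R) : 0 < p ->
  K * expR (- (p * ln n.+2%:R)) @[n --> \oo] --> (0 : R).
Proof.
move=> p0; rewrite -[X in _ --> X](mulr0 K).
by apply: cvgM (cvg_expR_ln0 p0); exact: cvg_cst.
Qed.

End ComplexFTC.

(** * Kummer's equation for the Laplace integral, and the functional equation of Gamma *)

Section TricomiKernel.
Context {R : realType}.
Local Notation mu := (@lebesgue_measure R).
Implicit Types (a be : R[i]).

(** For Kummer's equation with parameters [a] and [b], [be] is [b - a - 1]. It is kept free because
    [be = 0] gives Euler's integral and [be = -1] gives the functional equation of Gamma. *)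
Definition tricomi_kernel a be (s : R) : R[i] := cpow s (a - 1) * cpow (1 + s) be.

Lemma Re_sub1 a : Re (a - 1) = Re a - 1.
Proof. by rewrite Re_add Re_opp. Qed.

Lemma normc_tricomi_kernel a be (c s : R) :
  normc ((expR (- (c * s)))%:C * tricomi_kernel a be s) =
  expR ((Re a - 1) * ln s + Re be * ln (1 + s) - c * s).
Proof.
rewrite !Normc.normcM normc_real ger0_norm ?expR_ge0// !normc_cpow.
by rewrite Re_sub1 [in RHS]addrC !expRD.
Qed.

Lemma cmeasurable_tricomi_kernel a be : cmeasurable (tricomi_kernel a be).
Proof.
apply: cmeasurableM; apply: cmeasurable_cpow; first exact: measurable_id.
by apply: measurable_funD; [exact: measurable_cst|exact: measurable_id].
Qed.

Lemma measurable_expR_lin (c : R) : measurable_fun setT (fun s : R => expR (- (c * s))).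
Proof.
apply: measurableT_comp; first exact: measurable_expR.
exact: measurableT_comp.
Qed.

Lemma claplaceable_tricomi_kernel a be : 0 < Re a ->
  claplaceable (tricomi_kernel a be).
Proof.
move=> a0; split; first exact: cmeasurable_tricomi_kernel.
move=> c c0; apply: le_cintegrable (integrable_ln_kernel (Re be) a0 c0) _ => //.
  apply: cmeasurableM; last exact: cmeasurable_tricomi_kernel.
  by apply: cmeasurable_real; exact: measurable_expR_lin.
by move=> s _; rewrite normc_tricomi_kernel.
Qed.

Lemma is_derive_add1 (t : R) : is_derive t 1 (fun s : R => 1 + s) 1.
Proof.
rewrite -[X in is_derive _ _ _ X]add0r.
exact: (@is_deriveD_fun R (fun=> 1) id).
Qed.

Lemma is_cderive_tricomi_kernel a be (s : R) : 0 < s ->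
  is_cderive (tricomi_kernel a be) s
    (((a - 1) / s%:C + be / (1 + s)%:C) * tricomi_kernel a be s).
Proof.
move=> s0; have s1 : 0 < 1 + s by rewrite addr_gt0.
have h1 := is_cderive_cpow (u := id) (a - 1) s0 (is_derive_id s 1).
have h2 := is_cderive_cpow (u := fun s => 1 + s) be s1 (is_derive_add1 s).
apply: is_cderive_eq (is_cderiveM h1 h2) _.
by rewrite /tricomi_kernel /=; ring.
Qed.

Lemma is_cderive_expR_lin (t s : R) :
  is_cderive (fun s => (expR (- (t * s)))%:C) s (- t%:C * (expR (- (t * s)))%:C).
Proof.
have d : is_derive s 1 (fun s : R => - (t * s)) (- (t * 1)).
  by apply: is_deriveN_fun; exact: (@is_deriveZ_fun R id).
apply: is_cderive_eq (is_cderive_real (is_derive_comp_fun (is_derive_expR _) d)) _.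
by rewrite mulr1 mulrC rmorphM rmorphN.
Qed.

(* The three moments of the kernel are the values of the Laplace transform and
   of minus its first and plus its second derivative. *)
Lemma tricomi_kernel_moments a be (t : R) : 0 < Re a -> 0 < t ->
  let k := tricomi_kernel a be in
  t%:C * claplace (fun s => s%:C * (s%:C * k s)) t
  - (a + be + 1 - t%:C) * claplace (fun s => s%:C * k s) t
  - a * claplace k t = 0.
Proof.
move=> a0 t0 k.
have L0 := claplaceable_tricomi_kernel be a0.
have L1 := claplaceableX L0.
have L2 := claplaceableX L1.
pose e s := (expR (- (t * s)))%:C : R[i].
have mD : measurable (`]0, +oo[%classic : set R) by exact: measurable_itv.
have i0 : cintegrable `]0, +oo[ (fun s => e s * k s) by apply: L0.2.
have i1 : cintegrable `]0, +oo[ (fun s => e s * (s%:C * k s)) by apply: L1.2.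
have i2 : cintegrable `]0, +oo[ (fun s => e s * (s%:C * (s%:C * k s))) by apply: L2.2.
pose g s := t%:C * (e s * (s%:C * (s%:C * k s))) +
   (- (a + be + 1 - t%:C) * (e s * (s%:C * k s)) + - a * (e s * k s)).
have ig1 : cintegrable `]0, +oo[
    (fun s => - (a + be + 1 - t%:C) * (e s * (s%:C * k s)) + - a * (e s * k s)).
  by apply: cintegrableD => //; exact: cintegrableZ.
have ig2 : cintegrable `]0, +oo[ (fun s => t%:C * (e s * (s%:C * (s%:C * k s)))).
  exact: cintegrableZ.
have ig : cintegrable `]0, +oo[ g by exact: cintegrableD.
have -> : t%:C * claplace (fun s => s%:C * (s%:C * k s)) t
    - (a + be + 1 - t%:C) * claplace (fun s => s%:C * k s) t - a * claplace k t =
    cintegral `]0, +oo[ g.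
  rewrite /g cintegralD// cintegralD ?cintegralZ//; last 2 first.
  - exact: cintegrableZ.
  - exact: cintegrableZ.
  by rewrite !mulNr addrA.
have me : cmeasurable e by apply: cmeasurable_real; exact: measurable_expR_lin.
have mX : cmeasurable (fun s : R => s%:C).
  by apply: cmeasurable_real; exact: measurable_id.
have mk := cmeasurable_tricomi_kernel a be.
have mg : cmeasurable g.
  have mk1 := cmeasurableM mX mk; have mk2 := cmeasurableM mX mk1.
  have mZ c f : cmeasurable f -> cmeasurable (fun s : R => c * (e s * f s)).
    move=> mf; exact: cmeasurableM (cmeasurable_cst c) (cmeasurableM me mf).
  exact: cmeasurableD (mZ _ _ mk2) (cmeasurableD (mZ _ _ mk1) (mZ _ _ mk)).
(* The sign makes [g] the derivative of [G]: both reduce to [e s * k s * (t s (1 + s) - a (1 + s) -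
   (be + 1) s)], because [s^a (1 + s)^(be + 1)] is [s (1 + s) k s]. *)
pose G s := - (e s * (cpow s a * cpow (1 + s) (be + 1))).
have GE s : 0 < s -> normc (G s) =
    expR (Re a * ln s + (Re be + 1) * ln (1 + s) - t * s).
  move=> s0; rewrite /G normcN; have := normc_tricomi_kernel (a + 1) (be + 1) t s.
  by rewrite /tricomi_kernel addrK !Re_add /= addrK.
(* The order [Re a + 1] bounds [|G|] by [K s^(Re a) (1 + s)^(- Re a - 1)], hence by [K s^(Re a)],
   used at 0, and by [K / s], used at infinity. *)
have [K K0 hK] := kernel_bound (Re a) (Re be + 1) (Re a + 1) t0.
apply: (@cintegral_derive0 R G g mg ig).
- move=> s s0; have s1 : 0 < 1 + s by rewrite addr_gt0.
  have h1 := is_cderive_cpow (u := id) a s0 (is_derive_id s 1).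
  have h2 := is_cderive_cpow (u := fun s => 1 + s) (be + 1) s1 (is_derive_add1 s).
  have h3 := is_cderive_expR_lin t s.
  apply: is_cderive_eq (is_cderiveN (is_cderiveM h3 (is_cderiveM h1 h2))) _.
  rewrite /g /k /tricomi_kernel cpowB [cpow _ (be + 1)]cpowD !cpow1// -/(e s).
  rewrite !mulr1 [(1 + s)%:C]rmorphD/=.
  have n0 := real_complex_neq0 s0.
  have := real_complex_neq0 s1; rewrite rmorphD /= => n1.
  by field; rewrite n0 n1.
- move=> s s0.
  have hk := is_cderive_tricomi_kernel a be s0.
  have he := is_cderive_expR_lin t s.
  have hX := is_cderive_real (is_derive_id s 1).
  have hZ c f z : is_cderive f s z ->
      exists z', is_cderive (fun s => c * (e s * f s)) s z'.
    move=> hf; have h := is_cderiveZ c (is_cderiveM he hf).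
    by eexists; exact: h.
  have [z2 h2] := hZ t%:C _ _ (is_cderiveM hX (is_cderiveM hX hk)).
  have [z1 h1] := hZ (- (a + be + 1 - t%:C)) _ _ (is_cderiveM hX hk).
  have [z0 h0] := hZ (- a) _ _ hk.
  have h := is_cderiveD h2 (is_cderiveD h1 h0).
  by eexists; exact: h.
- have h := cvg_mul_expR_ln0 K a0.
  apply: (cvg_norm_le0 h) => n.
  have n0 : 0 < n.+2%:R^-1 :> R by rewrite invr_gt0.
  rewrite GE// ger0_norm ?expR_ge0//.
  apply: le_trans (hK _ n0) _; rewrite ler_pM2l// ler_expR.
  rewrite lnV ?posrE// mulrN lerBlDr lerDl mulr_ge0 ?ln_ge0 ?lerDl ?(ltW n0)//.
  by rewrite addr_ge0// ltW.
- have h := cvg_mul_expR_ln0 K (@ltr01 R).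
  apply: (cvg_norm_le0 h) => n.
  rewrite GE// ger0_norm ?expR_ge0//.
  apply: le_trans (hK _ (ltr0Sn _ _)) _; rewrite ler_pM2l// ler_expR.
  have h1 : ln (n.+2%:R : R) <= ln (1 + n.+2%:R).
    by rewrite ler_ln ?posrE ?addr_gt0// lerDr.
  have := ler_wpM2l (ltW a0) h1; rewrite mulrDl mul1r; lra.
Qed.

Lemma GammaE a : Gamma a = claplace (fun s => cpow s (a - 1)) 1.
Proof.
by apply: eq_cintegral => s _; rewrite mul1r mulrC.
Qed.

Lemma cpow_tricomi_kernel (s : R) a : cpow s (a - 1) = tricomi_kernel a 0 s.
Proof. by rewrite /tricomi_kernel cpow0 mulr1. Qed.

(** Let [M0], [M1], [M2] be the moments of the kernel with [be = -1] at [t = 1]. Since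
    [s^(a-1) = (1 + s) k s], one has [Gamma a = M0 + M1] and [Gamma (a + 1) = M1 + M2], and the
    moment identity [M2 = (a - 1) M1 + a M0] is the claim. *)
Lemma GammaS a : 0 < Re a -> Gamma (a + 1) = a * Gamma a.
Proof.
move=> a0; have := tricomi_kernel_moments (-1) a0 ltr01.
pose k := tricomi_kernel a (-1).
have L0 := claplaceable_tricomi_kernel (-1) a0.
have L1 := claplaceableX L0.
have L2 := claplaceableX L1.
have mD : measurable (`]0, +oo[%classic : set R) by exact: measurable_itv.
have kE (s : R) : 0 < s -> cpow s (a - 1) = k s + s%:C * k s.
  move=> s0; rewrite /k /tricomi_kernel cpowN cpow1 ?addr_gt0//.
  have := real_complex_neq0 (addr_gt0 ltr01 s0).
  by rewrite rmorphD/= => n1; field.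
have -> : Gamma a = claplace k 1 + claplace (fun s => s%:C * k s) 1.
  rewrite GammaE -cintegralD; [|exact: mD|exact: L0.2|exact: L1.2].
  apply: eq_cintegral => s /gt0_itvP s0.
  by rewrite kE// mulrDr.
have -> : Gamma (a + 1) = claplace (fun s => s%:C * k s) 1 +
    claplace (fun s => s%:C * (s%:C * k s)) 1.
  rewrite GammaE -cintegralD; [|exact: mD|exact: L1.2|exact: L2.2].
  apply: eq_cintegral => s /gt0_itvP s0.
  by rewrite addrAC cpowD cpow1// kE//; ring.
rewrite -/k => /eqP; rewrite subr_eq0 => /eqP h.
rewrite mulrDr -h; ring.
Qed.

End TricomiKernel.

(** * Linear change of variable *)

Section Scaling.
Context {R : realType}.
Local Notation mu := (@lebesgue_measure R).
Variable c : R.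
Hypothesis c0 : 0 < c.

Let phi : R -> R := fun t => c * t.

Let mphi : measurable_fun setT phi.
Proof. by apply: measurable_funM; [exact: measurable_cst|exact: measurable_id]. Qed.

Let push : {measure set (measurableTypeR R) -> \bar R}.
Proof. unshelve refine (pushforward mu (phi : measurableTypeR R -> measurableTypeR R) : {measure set _ -> \bar R}); exact: mphi. Defined.

Let c_nng : {nonneg R} := NngNum (ltW c0).

(** By uniqueness of Lebesgue measure only half-open intervals have to be compared, and the preimage
    of []a, b]] under [phi] is []a / c, b / c]]. *)
Let lebesgue_measure_scale (A : set R) : measurable A ->
  mu A = mscale c_nng push A.
Proof.
apply: (lebesgue_measure_unique (mu := mscale c_nng push)).
move=> X [[a b] _ <-]; pose Y : set R := `]a / c, b / c]%classic.
transitivity (c%:E * mu Y)%E; last first.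
  congr (_ * mu _)%E.
  apply/seteqP; split => t; rewrite /Y /= !in_itv/= /phi ltr_pdivrMr// ler_pdivlMr//;
  by rewrite mulrC.
rewrite /Y !lebesgue_measure_itv /= !lte_fin ltr_pM2r ?invr_gt0//.
case: ifPn => _; last by rewrite mule0.
rewrite -!EFinD -EFinM; congr (_%:E); field; exact: lt0r_neq0.
Qed.

Let ge0_integral_scale (x : R) (f : R -> \bar R) : measurable_fun setT f ->
  (forall t, 0 <= f t)%E ->
  (\int[mu]_(v in `](c * x)%R, +oo[) f v =
   c%:E * \int[mu]_(t in `]x, +oo[) f (c * t)%R)%E.
Proof.
move=> mf f0.
rewrite (eq_measure_integral (mscale c_nng push)); last first.
  by move=> A mA _; exact: lebesgue_measure_scale.
rewrite ge0_integral_mscale//=; last exact: measurable_funTS.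
congr (_ * _)%E.
transitivity (\int[mu]_(t in phi @^-1` `](c * x)%R, +oo[) (f \o phi) t)%E.
  by apply: ge0_integral_pushforward => //; exact: measurable_funTS.
congr integral.
by apply/seteqP; split => t /=; rewrite !in_itv/= !andbT /phi ltr_pM2l.
Qed.

(** Positive and negative parts are scaled separately; integrability makes the negative part finite,
    which allows [c] to be factored out of the extended-real difference. *)
Lemma Rintegral_scale (x : R) (f : R -> R) : measurable_fun setT f ->
  mu.-integrable `]x, +oo[ (fun t => (f (c * t))%:E) ->
  \int[mu]_(v in `]c * x, +oo[) f v = c * \int[mu]_(t in `]x, +oo[) f (c * t).
Proof.
move=> mf fi; rewrite /Rintegral.
have mEf : measurable_fun setT (EFin \o f) by exact/measurable_EFinP.
have -> : (\int[mu]_(v in `](c * x)%R, +oo[) (f v)%:E =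
   c%:E * \int[mu]_(t in `]x, +oo[) (f (c * t))%:E)%E.
  rewrite integralE.
  rewrite -[X in (X - _)%E]/(\int[mu]_(v in `](c * x)%R, +oo[) (EFin \o f)^\+ v)%E.
  rewrite -[X in (_ - X)%E]/(\int[mu]_(v in `](c * x)%R, +oo[) (EFin \o f)^\- v)%E.
  rewrite (ge0_integral_scale x (measurable_funepos mEf))//.
  rewrite (ge0_integral_scale x (measurable_funeneg mEf))//.
  rewrite -muleBr//.
    congr (_ * _)%E; rewrite [RHS]integralE.
    congr (_ - _)%E; apply: eq_integral => t _.
      by rewrite !unlock.
    by rewrite !unlock.
  apply: fin_num_adde_defl; rewrite fin_numN.
  have /integrable_neg_fin_num h := fi.
  by move: (h (measurable_itv _)); rewrite [@funeneg]unlock.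
by rewrite fineM//; exact: integrable_fin_num.
Qed.

End Scaling.

Section ComplexScaling.
Context {R : realType}.

Lemma cintegral_scale (c x : R) (f : R -> R[i]) : 0 < c -> cmeasurable f ->
  cintegrable `]x, +oo[ (fun t => f (c * t)) ->
  cintegral `]c * x, +oo[ f = c%:C * cintegral `]x, +oo[ (fun t => f (c * t)).
Proof.
move=> c0 [m1 m2] [i1 i2]; apply: complex_ext.
  by rewrite Re_real_mul /= (Rintegral_scale c0 m1 i1).
by rewrite Im_real_mul /= (Rintegral_scale c0 m2 i2).
Qed.

End ComplexScaling.

(** * Dominated convergence for complex-valued functions *)

Section DominatedConvergence.
Context {R : realType}.
Local Notation mu := (@lebesgue_measure R).
Variables (D : set R) (mD : measurable D) (g : R -> R).
Hypothesis ig : mu.-integrable D (EFin \o g).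

Let dominated_cvg_Rintegral (f_ : nat -> R -> R) (f : R -> R) :
  (forall n, measurable_fun setT (f_ n)) -> measurable_fun setT f ->
  (forall x, D x -> f_ n x @[n --> \oo] --> f x) ->
  (forall n x, D x -> `|f_ n x| <= g x) ->
  \int[mu]_(x in D) f_ n x @[n --> \oo] --> \int[mu]_(x in D) f x.
Proof.
move=> mf_ mf cvf bf.
have := @dominated_convergence _ _ _ mu _ mD (fun n => EFin \o f_ n)
  (EFin \o f) (EFin \o g).
case.
- move=> n; apply/measurable_EFinP; apply: measurable_funTS; exact: mf_.
- by apply/measurable_EFinP; exact: measurable_funTS.
- apply: aeW => x Dx; apply: cvg_EFin; first exact: nearW.
  exact: cvf.
- exact: ig.
- by apply: aeW => x n Dx; rewrite lee_fin; exact: bf.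
move=> if_ _ h.
have E : (\int[mu]_(x in D) (EFin \o f) x)%E = (\int[mu]_(x in D) f x)%:E.
  by rewrite fineK//; exact: integrable_fin_num.
by rewrite E in h; move/fine_cvg : h.
Qed.

Lemma cvg_normc0 (u : nat -> R[i]) (l : R[i]) :
  Re (u n) @[n --> \oo] --> Re l -> Im (u n) @[n --> \oo] --> Im l ->
  normc (u n - l) @[n --> \oo] --> (0 : R).
Proof.
move=> h1 h2.
have h : `|Re (u n) - Re l| + `|Im (u n) - Im l| @[n --> \oo] --> (0 : R).
  have c0 (v : R^nat) (k : R) : v n @[n --> \oo] --> k ->
      `|v n - k| @[n --> \oo] --> (0 : R).
    move=> vk; rewrite -(@normr0 _ R); apply: cvg_norm.
    by rewrite -(subrr k); apply: cvgB => //; exact: cvg_cst.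
  by rewrite -[X in _ --> X]addr0; apply: cvgD; exact: c0.
apply: (cvg_norm_le0 h) => n; rewrite ger0_norm ?normc_ge0//.
by rewrite -Re_opp -Re_add -Im_opp -Im_add normc_le_ReIm.
Qed.

Lemma dominated_cvg_cintegral (f_ : nat -> R -> R[i]) (f : R -> R[i]) :
  (forall n, cmeasurable (f_ n)) -> cmeasurable f ->
  (forall x, D x -> Re (f_ n x) @[n --> \oo] --> Re (f x)) ->
  (forall x, D x -> Im (f_ n x) @[n --> \oo] --> Im (f x)) ->
  (forall n x, D x -> normc (f_ n x) <= g x) ->
  normc (cintegral D (f_ n) - cintegral D f) @[n --> \oo] --> (0 : R).
Proof.
move=> mf_ [m1 m2] c1 c2 bf; apply: cvg_normc0.
  apply: (@dominated_cvg_Rintegral (fun n => Re \o f_ n) (Re \o f)) => //.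
    by move=> n; case: (mf_ n).
  by move=> n x Dx; apply: le_trans (normr_Re_le _) (bf _ _ Dx).
apply: (@dominated_cvg_Rintegral (fun n => Im \o f_ n) (Im \o f)) => //.
  by move=> n; case: (mf_ n).
by move=> n x Dx; apply: le_trans (normr_Im_le _) (bf _ _ Dx).
Qed.

End DominatedConvergence.

(** * Behaviour of the Laplace integral at infinity *)

Section Asymptotics.
Context {R : realType}.

Lemma measurable_expRN : measurable_fun setT (fun v : R => expR (- v)).
Proof. by have := @measurable_expR_lin R 1; under eq_fun do rewrite mul1r. Qed.

Variables (a be : R[i]).
Hypothesis a0 : 0 < Re a.

(** The integrand of [t^a I(t)] after the substitution [u = t s]; as [t] grows its last factor tends
    to 1 and Euler's integrand for [Gamma a] remains. *)
Let f (t u : R) : R[i] :=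
  (expR (- u))%:C * cpow u (a - 1) * cpow (1 + u / t) be.

Let mf t : cmeasurable (f t).
Proof.
have h : cmeasurable (fun u : R => cpow (1 + u / t) be).
  apply: cmeasurable_cpow; apply: measurable_funD; first exact: measurable_cst.
  by apply: measurable_funM; [exact: measurable_id|exact: measurable_cst].
apply: cmeasurableM => //; apply: cmeasurableM; last first.
  by apply: cmeasurable_cpow; exact: measurable_id.
apply: cmeasurable_real; exact: measurable_expRN.
Qed.

Lemma claplace_tricomi_kernel_scale (t : R) : 0 < t ->
  cpow t a * claplace (tricomi_kernel a be) t = cintegral `]0, +oo[ (f t).
Proof.
move=> t0.
have mD : measurable (`]0, +oo[%classic : set R) by exact: measurable_itv.
have tE : cpow t a = t%:C * cpow t (a - 1).
  by rewrite -[in RHS](cpow1 t0) -cpowD addrC subrK.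
have fE s : 0 < s -> cpow t (a - 1) * ((expR (- (t * s)))%:C * tricomi_kernel a be s) =
    f t (t * s).
  move=> s0; rewrite /f /tricomi_kernel cpowMl// [t * s / t]mulrAC divff ?gt_eqF// mul1r.
  ring.
have i0 := (claplaceable_tricomi_kernel be a0).2 _ t0.
have := @cintegral_scale R t 0 (f t) t0 (mf t); rewrite mulr0 => ->.
  rewrite tE -mulrA; congr (_ * _); rewrite /claplace -cintegralZ//.
  by apply: eq_cintegral => s /gt0_itvP/fE.
apply: eq_cintegrable mD _ (cintegrableZ (cpow t (a - 1)) mD i0) => s.
by move=> /gt0_itvP/fE.
Qed.

Lemma claplace_tricomi_kernel_asymp :
  normc (cpow t a * claplace (tricomi_kernel a be) t - Gamma a) @[t --> +oo] --> (0 : R).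
Proof.
apply/cvg_pinftyP => t tcvg.
(* Dominated convergence is applied along a sequence, shifted so that all its terms are at least 1.
   Then [v / u n <= v], and the last factor of [f] is bounded by [(1 + v)^|Re be|] uniformly in
   [n]. *)
have [N _ tN] : \forall n \near \oo, 1 <= t n by move/cvgryPge : tcvg; apply.
rewrite -(cvg_shiftn N); set u := fun n => t (n + N)%N.
have u1 n : 1 <= u n by apply: tN => /=; exact: leq_addl.
have u0 n : 0 < u n by apply: lt_le_trans (u1 n).
have ucvg : u n @[n --> \oo] --> +oo by rewrite (cvg_shiftn N).
under eq_fun do rewrite -/(u _) claplace_tricomi_kernel_scale//.
have mD : measurable (`]0, +oo[%classic : set R) by exact: measurable_itv.
have ig := integrable_ln_kernel `|Re be| a0 (@ltr01 R).
pose f1 (v : R) : R[i] := cpow v (a - 1) * (expR (- v))%:C.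
have fE n v : f (u n) v = f1 v * cpow (1 + v / u n) be.
  by rewrite /f /f1 [in RHS]mulrC [cpow v _ * _]mulrC mulrC.
have cv v : 0 < v -> (1 + v / u n) @[n --> \oo] --> (1 : R).
  move=> v0; rewrite -[X in _ --> X]addr0; apply: cvgD; first exact: cvg_cst.
  rewrite -(mulr0 v); apply: cvgM; first exact: cvg_cst.
  by apply/gtr0_cvgV0 => //; apply: nearW => n.
have [cR cI] : (forall v : R, 0 < v -> Re (cpow (1 + v / u n) be) @[n --> \oo] --> (1 : R)) /\
    (forall v : R, 0 < v -> Im (cpow (1 + v / u n) be) @[n --> \oo] --> (0 : R)).
  have [h1 h2] := is_cderive_continuous (is_cderive_cpow (u := id) (t := 1 : R) be ltr01 (is_derive_id (1 : R) 1)).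
  have E := cpow1l be.
  split=> v v0.
    rewrite [X in _ --> X](_ : 1 = Re (cpow 1 be)); last by rewrite E.
    exact: (cvg_comp _ _ (cv _ v0) h1).
  rewrite [X in _ --> X](_ : 0 = Im (cpow 1 be)); last by rewrite E.
  exact: (cvg_comp _ _ (cv _ v0) h2).
apply: (@dominated_cvg_cintegral R _ mD _ ig (fun n => f (u n)) f1) => //.
- apply: cmeasurableM; first by apply: cmeasurable_cpow; exact: measurable_id.
  by apply: cmeasurable_real; exact: measurable_expRN.
- move=> v /gt0_itvP v0.
  rewrite [X in X @ _ --> _](_ : _ = fun n => Re (f1 v) * Re (cpow (1 + v / u n) be) -
      Im (f1 v) * Im (cpow (1 + v / u n) be)); last first.
    by apply/funext => n; rewrite -Re_mul -fE.
  rewrite -[X in _ --> X]subr0 -[X in _ --> X - _]mulr1 -[X in _ --> _ - X](mulr0 (Im (f1 v))).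
  by apply: cvgB; apply: cvgM; [exact: cvg_cst|exact: cR|exact: cvg_cst|exact: cI].
- move=> v /gt0_itvP v0.
  rewrite [X in X @ _ --> _](_ : _ = fun n => Re (f1 v) * Im (cpow (1 + v / u n) be) +
      Im (f1 v) * Re (cpow (1 + v / u n) be)); last first.
    by apply/funext => n; rewrite -Im_mul -fE.
  rewrite -[X in _ --> X]add0r -[X in _ --> _ + X]mulr1 -[X in _ --> X + _](mulr0 (Re (f1 v))).
  by apply: cvgD; apply: cvgM; [exact: cvg_cst|exact: cI|exact: cvg_cst|exact: cR].
- move=> n v /gt0_itvP v0.
  rewrite -[X in normc X]/((expR (- v))%:C * cpow v (a - 1) * cpow (1 + v / u n) be).
  rewrite !Normc.normcM normc_real ger0_norm ?expR_ge0// !normc_cpow Re_sub1.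
  have h1 : 0 < v / u n by rewrite divr_gt0.
  have h2 : 0 <= ln (1 + v / u n) by rewrite ln_ge0// lerDl ltW.
  have h3 : Re be * ln (1 + v / u n) <= `|Re be| * ln (1 + v).
    apply: (@le_trans _ _ (`|Re be| * ln (1 + v / u n))).
      by rewrite ler_wpM2r// ler_norm.
    rewrite ler_wpM2l// ler_ln ?posrE ?addr_gt0//.
    by rewrite lerD2l ler_pdivrMr// ler_peMr// ltW.
  by rewrite -!expRD ler_expR mul1r; lra.
Qed.

End Asymptotics.

(** * Elementary inequalities for cosine and exponential *)

Section RealInequalities.
Context {R : realType}.

Lemma MVT_is_derive (f df : R -> R) (a b : R) : a < b ->
  (forall x : R, a <= x <= b -> is_derive x 1 f (df x)) ->
  exists2 c, a < c < b & f b - f a = df c * (b - a).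
Proof.
move=> ab d.
have [||c] := @MVT R f df a b ab.
- move=> x; rewrite in_itv/= => /andP[ax xb].
  by apply: d; rewrite (ltW ax) (ltW xb).
- apply: continuous_in_subspaceT => x; rewrite inE/= in_itv/= => xab.
  exact: is_derive_continuous (d _ xab).
by rewrite in_itv/= => cab E; exists c.
Qed.

Lemma normr_sin_le (x : R) : `|sin x| <= `|x|.
Proof.
wlog x0 : x / 0 <= x.
  move=> h; have [/h//|x0] := leP 0 x.
  by have := h (- x); rewrite sinN !normrN oppr_ge0; apply; exact: ltW.
have [->|xn0] := eqVneq x 0; first by rewrite sin0.
have {}x0 : 0 < x by rewrite lt_neqAle eq_sym xn0.
have [c _] := MVT_is_derive x0 (fun x _ => is_derive_sin x).
by rewrite sin0 !subr0 => ->; rewrite normrM ler_piMl// cos_max.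
Qed.

Lemma cos_ge_quadratic (x : R) : 1 - x ^+ 2 / 2 <= cos x.
Proof.
have -> : cos x = 1 - 2 * sin (x / 2) ^+ 2.
  have {1}-> : x = (x / 2) *+ 2 by rewrite -mulr_natr; field.
  by rewrite cos_mulr2n cos2sin2; ring.
have : sin (x / 2) ^+ 2 <= (x / 2) ^+ 2.
  rewrite -(real_normK (num_real (sin _))) -(real_normK (num_real (x / 2))).
  by rewrite lerXn2r ?nnegrE// normr_sin_le.
by lra.
Qed.

(** The right-hand side is [(e^l - e^(-l))^2]. At [l = ln (s / p) / 2] it becomes
    [s / p - 2 + p / s], so a squared logarithm is bounded by something whose Gamma moments are
    explicit. *)
Lemma sqr_le_expR2 (l : R) : l ^+ 2 <= expR (2 * l) - 2 + expR (- (2 * l)).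
Proof.
have h1 := expR_ge1Dx l; have h2 := expR_ge1Dx (- l).
have e0 := expR_gt0 l; have e1 := expR_gt0 (- l).
have ee : expR l * expR (- l) = 1 by rewrite expRxMexpNx_1.
have -> : expR (2 * l) = expR l ^+ 2 by rewrite expRM_natl.
have -> : expR (- (2 * l)) = expR (- l) ^+ 2.
  by rewrite -mulrN expRM_natl.
move: h1 h2 e0 e1 ee; set u := expR l; set v := expR (- l) => h1 h2 e0 e1 ee.
by have [l0|l0] := leP 0 l; nra.
Qed.

End RealInequalities.

(** * Gamma has no zero in the right half-plane *)

Section GammaNonzero.
Context {R : realType}.
Local Notation mu := (@lebesgue_measure R).

Definition rgamma (p : R) : R :=
  \int[mu]_(s in `]0, +oo[) expR ((p - 1) * ln s - s).

Lemma integrable_rgamma (p : R) : 0 < p ->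
  mu.-integrable `]0, +oo[ (fun s => (expR ((p - 1) * ln s - s))%:E).
Proof.
move=> p0; have := integrable_ln_kernel 0 p0 (@ltr01 R).
by apply: eq_integrable => // s _ /=; rewrite mul0r addr0 mul1r.
Qed.

Lemma measurable_rgamma (p : R) : measurable_fun setT (fun s => expR ((p - 1) * ln s - s)).
Proof.
have := measurable_ln_kernel (p - 1) 0 1.
by under eq_fun do rewrite mul0r addr0 mul1r.
Qed.

Lemma Gamma_real (p : R) : Gamma p%:C = (rgamma p)%:C.
Proof.
have E : p%:C - 1 = (p - 1)%:C :> R[i] by rewrite rmorphB.
apply: complex_ext.
  by apply: eq_Rintegral => s _; rewrite E cpow_real Re_real_mul expRD.
rewrite /Gamma E /cintegral -[Im _]/(Rintegral _ _ _) /Rintegral integral0_eq// => s _.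
by rewrite cpow_real Im_real_mul /= mulr0.
Qed.

Lemma rgammaS (p : R) : 0 < p -> rgamma (p + 1) = p * rgamma p.
Proof.
move=> p0; apply: complexI; rewrite rmorphM /= -!Gamma_real rmorphD /= rmorph1.
by rewrite GammaS.
Qed.

Lemma rgamma_gt0 (p : R) : 0 < p -> 0 < rgamma p.
Proof.
move=> p0; rewrite -lte_fin.
have -> : (rgamma p)%:E = (\int[mu]_(s in `]0%R, +oo[) (expR ((p - 1) * ln s - s))%:E)%E.
  by rewrite fineK//; apply: integrable_fin_num => //; exact: integrable_rgamma.
(* A lower bound for the integrand on [[1, 2]], where [|ln s| <= ln 2] and [s <= 2]. *)
pose c := expR (- (`|p - 1| * ln 2) - 2).
have mf : measurable_fun (`]0, +oo[%classic : set R)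
    (fun s => (expR ((p - 1) * ln s - s))%:E).
  by apply/measurable_EFinP/measurable_funTS; exact: measurable_rgamma.
have sub : (`[1, 2]%classic : set R) `<=` `]0, +oo[%classic.
  by move=> s /=; rewrite !in_itv/= andbT => /andP[+ _]; exact: lt_le_trans.
apply: (@lt_le_trans _ _ (\int[mu]_(s in `[1%R, 2%R]) c%:E)%E).
  rewrite integral_cst//= lebesgue_measure_itv /= lte_fin ltr1n -EFinB -EFinM lte_fin.
  by rewrite mulr_gt0 ?expR_gt0// subr_gt0 ltr1n.
apply: (@le_trans _ _ (\int[mu]_(s in `[1%R, 2%R]) (expR ((p - 1) * ln s - s))%:E)%E).
  apply: ge0_le_integral => //.
  - by move=> s _; rewrite lee_fin expR_ge0.
  - by apply: measurable_funS sub _ => //; exact: measurable_itv.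
  move=> s /=; rewrite in_itv/= => /andP[s1 s2]; rewrite lee_fin ler_expR.
  have s0 : 0 < s by apply: lt_le_trans s1.
  have l0 : 0 <= ln s by rewrite ln_ge0.
  have l2 : ln s <= ln 2 by rewrite ler_ln ?posrE.
  have := ler_wpM2l (normr_ge0 (p - 1)) l2.
  have := ler_wpM2r l0 (ler_norm (- (p - 1))).
  by rewrite normrN mulNr; lra.
by apply: ge0_subset_integral => // s _; rewrite lee_fin expR_ge0.
Qed.

Lemma cintegrable_Gamma (z : R[i]) : 0 < Re z ->
  cintegrable `]0, +oo[ (fun s : R => cpow s (z - 1) * (expR (- s))%:C).
Proof.
move=> z0; apply: eq_cintegrable ((claplaceable_tricomi_kernel 0 z0).2 _ ltr01) => // s _.
by rewrite mul1r mulrC cpow_tricomi_kernel.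
Qed.

(** A zero at [a] propagates to every [a + n] by the functional equation. With [p = Re a + n] and
    [tau = Im a], the real part of [p^(- i tau) Gamma (a + n)] is at least
    [Gamma p * (1 - 2 tau^2 / (p - 1))], which is positive once [p] is large. *)
Lemma Gamma_neq0 (a : R[i]) : 0 < Re a -> Gamma a != 0.
Proof.
move=> a0; apply/eqP => G0.
have Gn n : Gamma (a + n%:R) = 0.
  elim: n => [|n IH]; first by rewrite addr0.
  rewrite -addn1 natrD addrA GammaS ?IH ?mulr0//.
  rewrite Re_add (_ : Re n%:R = n%:R) ?ltr_wpDr//.
  by rewrite -(rmorph_nat (real_complex R)).
pose tau := Im a.
(* Large enough that [2 tau^2 < p - 1], the condition for the final lower bound to be positive. *)
pose n := (Num.trunc (2 * tau ^+ 2 + 2)).+1.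
pose p := Re a + n%:R.
have pn : 2 * tau ^+ 2 + 2 < p.
  apply: (@lt_trans _ _ n%:R); last by rewrite ltrDr.
  by rewrite truncnS_gt.
have t0 : 0 <= 2 * tau ^+ 2 by rewrite mulr_ge0// sqr_ge0.
have p0 : 0 < p by lra.
have p1 : 0 < p - 1 by lra.
have t1 : 2 * tau ^+ 2 < p - 1 by lra.
have aE : a + n%:R = p +i* tau.
  by apply: complex_ext; rewrite ?Re_add ?Im_add -(rmorph_nat (real_complex R)) //= addr0.
have := Gn n; rewrite aE => Gz.
pose e (s : R) : R := expR ((p - 1) * ln s - s).
have mD : measurable (`]0, +oo[%classic : set R) by exact: measurable_itv.
(* The constant [p^(- i tau)] rotates the integrand so that its phase [tau * (ln s - ln p)] vanishes
   at [s = p], near which the density is concentrated. *)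
pose h (s : R) := cpow p (0 -i* tau) * (cpow s (p +i* tau - 1) * (expR (- s))%:C).
have i0 : cintegrable `]0, +oo[ (fun s : R => cpow s (p +i* tau - 1) * (expR (- s))%:C).
  exact: cintegrable_Gamma.
have hE (s : R) : 0 < s -> Re (h s) = e s * cos (tau * (ln s - ln p)).
  move=> s0; rewrite /h mulrA mulrC Re_real_mul Re_mul /cpow.
  rewrite -[Re (Complex _ _)]/(_ * _) /= subr0 mul0r expR0 !mul1r mulNr cosN sinN.
  by rewrite /e expRD [tau * (_ - _)]mulrBr cosB; ring.
have eS (s : R) : 0 < s -> expR ((p + 1 - 1) * ln s - s) = e s * s.
  move=> s0; transitivity (e s * expR (ln s)); last by rewrite lnK.
  rewrite /e -expRD; congr expR; ring.
have eP (s : R) : 0 < s -> expR ((p - 1 - 1) * ln s - s) = e s / s.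
  move=> s0; transitivity (e s * expR (- ln s)); last by rewrite expRN lnK.
  rewrite /e -expRD; congr expR; ring.
(* This is [e s * (1 - 2 tau^2 (s / p - 2 + p / s))], obtained from [cos y >= 1 - y^2 / 2], and
   expanded so that its integral involves only [rgamma] at [p], [p + 1] and [p - 1]. *)
pose low (s : R) := (1 + 4 * tau ^+ 2) * e s -
  (2 * tau ^+ 2 / p * expR ((p + 1 - 1) * ln s - s) +
   2 * tau ^+ 2 * p * expR ((p - 1 - 1) * ln s - s)).
have lowE (s : R) : 0 < s -> low s <= Re (h s).
  move=> s0; rewrite /low eS// eP// hE//.
  have e0 : 0 < e s by exact: expR_gt0.
  have -> : (1 + 4 * tau ^+ 2) * e s - (2 * tau ^+ 2 / p * (e s * s) +
      2 * tau ^+ 2 * p * (e s / s)) =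
      e s * (1 - 2 * tau ^+ 2 * (s / p - 2 + p / s)).
    by field; rewrite !gt_eqF.
  rewrite ler_pM2l//; apply: le_trans (cos_ge_quadratic _).
  have := sqr_le_expR2 ((ln s - ln p) / 2).
  have -> : 2 * ((ln s - ln p) / 2) = ln s - ln p by field.
  rewrite opprB !expRB !lnK ?posrE// => k1.
  have := ler_wpM2l t0 k1; rewrite exprMn; lra.
have j0 := integrable_rgamma p0.
have jS : mu.-integrable `]0, +oo[ (fun s => (expR ((p + 1 - 1) * ln s - s))%:E).
  by apply: integrable_rgamma; rewrite addr_gt0.
have jP := integrable_rgamma p1.
have ilow : mu.-integrable `]0, +oo[ (EFin \o low).
  rewrite (_ : _ \o _ = fun s => (((1 + 4 * tau ^+ 2) * e s)%:E -
    ((2 * tau ^+ 2 / p * expR ((p + 1 - 1) * ln s - s))%:E +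
     (2 * tau ^+ 2 * p * expR ((p - 1 - 1) * ln s - s))%:E))%E)//.
  apply: integrableB => //; first exact: integrable_EFinZl.
  by apply: integrableD => //; exact: integrable_EFinZl.
have ih := cintegrableZ (cpow p (0 -i* tau)) mD i0.
have Lle : \int[mu]_(s in `]0, +oo[) low s <= \int[mu]_(s in `]0, +oo[) Re (h s).
  by apply: le_Rintegral => //; [exact: ih.1|move=> s /gt0_itvP; exact: lowE].
have h0 : \int[mu]_(s in `]0, +oo[) Re (h s) = 0.
  have := cintegralZ (cpow p (0 -i* tau)) mD i0.
  by rewrite -/(Gamma (p +i* tau)) Gz mulr0 => /(congr1 Re).
have L0 : \int[mu]_(s in `]0, +oo[) low s = rgamma p * (1 - 2 * tau ^+ 2 / (p - 1)).
  rewrite /low RintegralB//; last 2 first.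
  - exact: integrable_EFinZl.
  - rewrite (_ : _ \o _ = fun s =>
     ((2 * tau ^+ 2 / p * expR ((p + 1 - 1) * ln s - s))%:E +
     (2 * tau ^+ 2 * p * expR ((p - 1 - 1) * ln s - s))%:E)%E)//.
    by apply: integrableD => //; exact: integrable_EFinZl.
  rewrite RintegralD//; [|exact: integrable_EFinZl|exact: integrable_EFinZl].
  rewrite !RintegralZl// -/(rgamma p) -/(rgamma (p + 1)) -/(rgamma (p - 1)).
  have := rgammaS p1; rewrite subrK rgammaS// => ->.
  by field; rewrite !gt_eqF.
have pos : 0 < rgamma p * (1 - 2 * tau ^+ 2 / (p - 1)).
  by rewrite mulr_gt0 ?rgamma_gt0// subr_gt0 ltr_pdivrMr// mul1r.
by move: Lle; rewrite h0 L0 leNgt pos.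
Qed.

End GammaNonzero.

(** * Consequences of the mean value theorem for complex-valued functions *)

Section MeanValue.
Context {R : realType}.
Implicit Types (f g : R -> R[i]) (T : R).

(** Cauchy-Schwarz in the plane: the left-hand side is the absolute real part of the conjugate of
    [z] times [w]. *)
Lemma Re_dot_le (z w : R[i]) : `|Re z * Re w + Im z * Im w| <= normc z * normc w.
Proof.
have -> : normc z = normc (Re z -i* Im z) by rewrite !normcE /= sqrrN.
rewrite -Normc.normcM; apply: le_trans (normr_Re_le _).
by rewrite Re_mul /= mulNr opprK.
Qed.

Lemma is_cderive0_cst f T : (forall t : R, T < t -> is_cderive f t 0) ->
  forall s t, T < s -> T < t -> f s = f t.
Proof.
move=> df.
suff h s t : T < s -> s < t -> f s = f t.
  move=> s t Ts Tt; case: (ltgtP s t) => [st|ts|->//]; first exact: h.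
  by rewrite (h t s).
move=> Ts st; have d x : s <= x <= t -> is_cderive f x 0.
  by move=> /andP[sx _]; apply: df; exact: lt_le_trans sx.
apply: complex_ext.
  have [|c _ /eqP] := @MVT_is_derive R (Re \o f) (fun=> 0) s t st.
    by move=> x /d[].
  by rewrite mul0r => E; apply/esym/eqP; rewrite -subr_eq0.
have [|c _ /eqP] := @MVT_is_derive R (Im \o f) (fun=> 0) s t st.
  by move=> x /d[].
by rewrite mul0r => E; apply/esym/eqP; rewrite -subr_eq0.
Qed.

(** Thresholds are taken above 1 so that every later [t > M] is positive with a nonnegative
    logarithm. *)
Lemma cvg0_pinfty (F : R -> R) : F t @[t --> +oo] --> (0 : R) ->
  forall e : R, 0 < e -> exists2 M, 1 < M & forall t, M < t -> F t < e.
Proof.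
move=> F0 e e0; have [M [_ h]] : \forall t \near +oo, `|F t| < e.
  by apply: cvgr0_norm_lt.
have M0 := normr_ge0 M; have M1 := ler_norm M.
exists (`|M| + 2) => [|t Mt]; first lra.
by apply: le_lt_trans (ler_norm _) (h t _); lra.
Qed.

(** On [[t, t + 1]] the increment of [f] is small, yet it equals a value of [f'], which is close to
    [k]. The intermediate point differs for real and imaginary parts, hence the separate bounds; the
    three errors are [e / 3] each. *)
Lemma cderive_limit0 f (f' : R -> R[i]) (k : R[i]) T :
  (forall t : R, T < t -> is_cderive f t (f' t)) ->
  (forall e : R, 0 < e -> exists M, forall t, M < t -> normc (f t) < e) ->
  (forall e : R, 0 < e -> exists M, forall t, M < t -> normc (f' t - k) < e) -> k = 0.
Proof.
move=> df f0 fk; have key e : 0 < e -> `|Re k| <= e /\ `|Im k| <= e.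
  move=> e0; have e3 : 0 < e / 3 by rewrite divr_gt0.
  have [M1 h1] := f0 _ e3; have [M2 h2] := fk _ e3.
  pose t := `|T| + `|M1| + `|M2| + 1.
  have [? ? ?] := And3 (ler_norm T) (ler_norm M1) (ler_norm M2).
  have [? ? ?] := And3 (normr_ge0 T) (normr_ge0 M1) (normr_ge0 M2).
  have tT : T < t by rewrite /t; lra.
  have t1 : M1 < t by rewrite /t; lra.
  have t2 : M2 < t by rewrite /t; lra.
  have tt : t < t + 1 by rewrite ltrDl.
  have d x : t <= x <= t + 1 -> is_cderive f x (f' x).
    by move=> /andP[tx _]; apply: df; exact: lt_le_trans tx.
  have n1 := h1 _ t1; have n2 := h1 _ (lt_trans t1 tt).
  split.
    have [|c /andP[tc _]] := @MVT_is_derive R (Re \o f) (fun x => Re (f' x)) t (t + 1) tt.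
      by move=> x /d[].
    rewrite (_ : t + 1 - t = 1) ?mulr1 => [E|]; last ring.
    have n3 := le_lt_trans (normr_Re_le _) (h2 _ (lt_trans t2 tc)).
    have n4 := le_lt_trans (normr_Re_le _) n1; have n5 := le_lt_trans (normr_Re_le _) n2.
    move: n3 n4 n5; rewrite Re_add Re_opp -E !ltr_norml ler_norml => /andP[? ?] /andP[? ?] /andP[? ?].
    by apply/andP; split; lra.
  have [|c /andP[tc _]] := @MVT_is_derive R (Im \o f) (fun x => Im (f' x)) t (t + 1) tt.
    by move=> x /d[].
  rewrite (_ : t + 1 - t = 1) ?mulr1 => [E|]; last ring.
  have n3 := le_lt_trans (normr_Im_le _) (h2 _ (lt_trans t2 tc)).
  have n4 := le_lt_trans (normr_Im_le _) n1; have n5 := le_lt_trans (normr_Im_le _) n2.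
  move: n3 n4 n5; rewrite Im_add Im_opp -E !ltr_norml ler_norml => /andP[? ?] /andP[? ?] /andP[? ?].
  by apply/andP; split; lra.
apply: complex_ext; apply/eqP; rewrite -normr_le0; apply/ler_addgt0Pl => e /key[];
  by rewrite addr0.
Qed.

(* Backward Gronwall: the energy |f|^2 + |f'|^2, multiplied by e^(K t), is nondecreasing. *)
Lemma cderive2_zero_backward f (f1 f2 : R -> R[i]) (s T A B : R) : s < T ->
  0 <= A -> 0 <= B ->
  (forall t : R, s <= t <= T -> is_cderive f t (f1 t)) ->
  (forall t : R, s <= t <= T -> is_cderive f1 t (f2 t)) ->
  (forall t : R, s <= t <= T -> normc (f2 t) <= A * normc (f t) + B * normc (f1 t)) ->
  f T = 0 -> f1 T = 0 -> f s = 0.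
Proof.
move=> sT A0 B0 d1 d2 h fT f1T.
pose N t := Re (f t) * Re (f t) + Im (f t) * Im (f t) +
  (Re (f1 t) * Re (f1 t) + Im (f1 t) * Im (f1 t)).
pose N' t := 2 * (Re (f t) * Re (f1 t) + Im (f t) * Im (f1 t)) +
  2 * (Re (f1 t) * Re (f2 t) + Im (f1 t) * Im (f2 t)).
have NE t : N t = normc (f t) ^+ 2 + normc (f1 t) ^+ 2.
  by rewrite !sqr_normc_ReIm /N !expr2.
have dN (t : R) : s <= t <= T -> is_derive t 1 N (N' t).
  move=> st; have [a1 a2] := d1 _ st; have [b1 b2] := d2 _ st.
  apply: is_derive_sub (is_deriveD_fun
    (is_deriveD_fun (is_deriveM_fun a1 a1) (is_deriveM_fun a2 a2))
    (is_deriveD_fun (is_deriveM_fun b1 b1) (is_deriveM_fun b2 b2))) _.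
  by rewrite /N' /=; ring.
(* With [u = |f|] and [v = |f'|], the derivative of the energy is at least
   [- 2 u v - 2 v (A u + B v)], and [2 u v <= u^2 + v^2] bounds this below by [- K * N]. *)
pose K := 1 + A + 2 * B.
have bN t : s <= t <= T -> 0 <= N' t + K * N t.
  move=> st; have h2 := h _ st.
  have := Re_dot_le (f t) (f1 t); have := Re_dot_le (f1 t) (f2 t).
  rewrite !ler_norml /N' NE => /andP[k1 _] /andP[k2 _].
  have n0 := normc_ge0 (f t); have n1 := normc_ge0 (f1 t).
  have k3 := ler_wpM2l n1 h2.
  move: k1 k2 k3 n0 n1; set u := normc (f t); set v := normc (f1 t).
  set p := Re (f t) * _ + _; set q := Re (f1 t) * _ + _ => k1 k2 k3 n0 n1.
  have k4 : 2 * (u * v) <= u ^+ 2 + v ^+ 2 by have := sqr_ge0 (u - v); rewrite sqrrB; lra.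
  have k5 := ler_wpM2l A0 k4.
  have k6 : 0 <= B * u ^+ 2 by rewrite mulr_ge0// sqr_ge0.
  rewrite /K; move: k1 k2 k3 k4 k5 k6; rewrite !expr2; nra.
pose F t := N t * expR (K * t).
have dF (t : R) : s <= t <= T -> is_derive t 1 F ((N' t + K * N t) * expR (K * t)).
  move=> st; have dK : is_derive t 1 (fun t : R => K * t) (K * 1).
    by apply: (@is_deriveZ_fun R id).
  apply: is_derive_sub (is_deriveM_fun (dN _ st)
    (is_derive_comp_fun (is_derive_expR _) dK)) _.
  by rewrite mulr1; ring.
have [c /andP[sc cT]] := MVT_is_derive sT dF.
have -> : F T = 0 by rewrite /F /N fT f1T /= !mulr0 !addr0 mul0r.
rewrite sub0r => E.
have Fs : F s <= 0.
  rewrite -oppr_ge0 E mulr_ge0 ?subr_ge0 ?(ltW sT)// mulr_ge0 ?expR_ge0//.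
  by apply: bN; rewrite (ltW sc) (ltW cT).
have Ns : N s <= 0 by move: Fs; rewrite /F pmulr_lle0 ?expR_gt0.
have := sqr_ge0 (normc (f1 s)); have := sqr_ge0 (normc (f s)).
move: Ns; rewrite NE => n1 n2 n3.
have /eqP : normc (f s) ^+ 2 = 0 by apply/eqP; rewrite eq_le n2 andbT; lra.
by rewrite sqrf_eq0 normc_eq0 => /eqP.
Qed.

End MeanValue.

(** * Uniqueness of the solution of Kummer's equation asymptotic to [t^(-a)] *)

Section TricomiUniqueness.
Context {R : realType}.
Variables (a b : R[i]) (w1 w2 : R -> R[i]).
Hypotheses (h1 : is_tricomiU a b w1) (h2 : is_tricomiU a b w2).

Let dw w (t : R) : is_tricomiU a b w -> 0 < t -> is_cderive w t (cderive w t).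
Proof. by move=> [h _] /h[d _ _]; exact: cderivable_is_cderive. Qed.

Let ddw w (t : R) : is_tricomiU a b w -> 0 < t ->
  is_cderive (cderive w) t (cderive (cderive w) t).
Proof. by move=> [h _] /h[_ d _]; exact: cderivable_is_cderive. Qed.

Let ode w (t : R) : is_tricomiU a b w -> 0 < t ->
  t%:C * cderive (cderive w) t = a * w t - (b - t%:C) * cderive w t.
Proof.
by move=> [h _] /h[_ _ /eqP]; rewrite subr_eq0 eq_sym => /eqP ->; ring.
Qed.

Let d t := w2 t - w1 t.
Let d' t := cderive w2 t - cderive w1 t.
Let d'' t := cderive (cderive w2) t - cderive (cderive w1) t.

Let is_cderive_d (t : R) : 0 < t -> is_cderive d t (d' t).
Proof. by move=> t0; apply: is_cderiveB; exact: dw. Qed.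

Let is_cderive_d' (t : R) : 0 < t -> is_cderive d' t (d'' t).
Proof. by move=> t0; apply: is_cderiveB; exact: ddw. Qed.

Let ode_sub (x y z x1 y1 z1 t : R[i]) : t * z = a * x - (b - t) * y ->
  t * z1 = a * x1 - (b - t) * y1 ->
  t * (z1 - z) = a * (x1 - x) - (b - t) * (y1 - y).
Proof. by move=> e e1; rewrite mulrBr e e1; ring. Qed.

Let ode_d (t : R) : 0 < t -> t%:C * d'' t = a * d t - (b - t%:C) * d' t.
Proof. by move=> t0; exact: ode_sub (ode h1 t0) (ode h2 t0). Qed.

Let W t := w1 t * d' t - cderive w1 t * d t.

Let is_cderive_W (t : R) : 0 < t ->
  is_cderive W t (w1 t * d'' t - cderive (cderive w1) t * d t).
Proof.
move=> t0; apply: is_cderive_eq (is_cderiveB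
  (is_cderiveM (dw h1 t0) (is_cderive_d' t0))
  (is_cderiveM (ddw h1 t0) (is_cderive_d t0))) _.
by ring.
Qed.

(** Abel's identity: the equation gives [W' = (1 - b / t) W], so that this multiple of the Wronskian
    is constant. *)
Let E (t : R) := (expR (- t))%:C * cpow t b * W t.

Let is_cderive_expRN (t : R) : is_cderive (fun t => (expR (- t))%:C) t (- (expR (- t))%:C).
Proof.
have := is_cderive_expR_lin 1 t; rewrite mul1r mulN1r.
by under [X in is_cderive X _ _ -> _]eq_fun do rewrite mul1r.
Qed.

Let is_cderive_E (t : R) : 0 < t -> is_cderive E t 0.
Proof.
move=> t0; have n0 := real_complex_neq0 t0.
have hc := is_cderive_cpow (u := id) b t0 (is_derive_id t 1).
apply: is_cderive_eq (is_cderiveM (is_cderiveM (is_cderive_expRN t) hc) (is_cderive_W t0)) _.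
have e1 : d'' t = (a * d t - (b - t%:C) * d' t) / t%:C by rewrite -ode_d//; field.
have e2 : cderive (cderive w1) t = (a * w1 t - (b - t%:C) * cderive w1 t) / t%:C.
  by rewrite -ode//; field.
by rewrite e1 e2 /W mulr1 /=; field.
Qed.

Let g1 (t : R) := w1 t / cpow t (- a).

Let g1E t : w1 t = g1 t * cpow t (- a).
Proof. by rewrite /g1 divfK ?cpow_neq0. Qed.

Let near_g1 (e : R) : 0 < e -> exists2 M, 1 < M & forall t, M < t -> normc (g1 t - 1) < e.
Proof. by apply: cvg0_pinfty; case: h1. Qed.

Let near_d (e : R) : 0 < e -> exists2 M, 1 < M &
  forall t, M < t -> normc (d t / cpow t (- a)) < e.
Proof.
move=> e0; have e2 : 0 < e / 2 by rewrite divr_gt0.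
have [M1 M11 hM1] := near_g1 e2.
have [M2 M21 hM2] := cvg0_pinfty h2.2 e2.
exists (M1 + M2) => [|t Mt]; first lra.
have -> : d t / cpow t (- a) = (w2 t / cpow t (- a) - 1) + - (g1 t - 1).
  by rewrite /d /g1; ring.
apply: le_lt_trans (le_normcD _ _) _; rewrite normcN.
have t1 : M1 < t by lra.
have t2 : M2 < t by lra.
by have := hM1 _ t1; have := hM2 _ t2; lra.
Qed.

Let q (t : R) := d t / w1 t.

(** Once [|g1 - 1| < 1 / 2], the modulus of [g1] is at least [1 / 2], so [w1] does not vanish and
    [|q| < (e / 2) / (1 / 2)]. *)
Let q_small (e : R) : 0 < e -> exists2 M, 1 < M &
  forall t, M < t -> [/\ w1 t != 0, 1 / 2 <= normc (g1 t) & normc (q t) < e].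
Proof.
move=> e0; have [M1 M11 hM1] := near_g1 (ltac:(lra) : 0 < 1 / 2 :> R).
have [M2 M21 hM2] := near_d (ltac:(lra) : 0 < e / 2 :> R).
exists (M1 + M2) => [|t Mt]; first lra.
have t1 : M1 < t by lra.
have t2 : M2 < t by lra.
have g12 : 1 / 2 <= normc (g1 t).
  have := le_normcD (g1 t) (- (g1 t - 1)).
  rewrite normcN (_ : g1 t + - (g1 t - 1) = 1); last by ring.
  by rewrite Normc.normc1; have := hM1 _ t1; lra.
have gn0 : g1 t != 0 by rewrite -normc_eq0 gt_eqF//; lra.
have wn0 : w1 t != 0 by rewrite g1E mulf_neq0 ?cpow_neq0.
split=> //; have -> : q t = d t / cpow t (- a) / g1 t.
  by rewrite /q /g1; field; rewrite wn0 cpow_neq0.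
rewrite Normc.normcM Normc.normcV ltr_pdivrMr; last lra.
by have := hM2 _ t2; nra.
Qed.

Let k := E 1.

(** Since [q' = W / w1^2 = k e^t t^(2a - b) / g1^2], this is the exponent for which [q' e^(-t) t^c]
    is [k / g1^2]. *)
Let c := b - 2 * a.

Let r (t : R) := q t * ((expR (- t))%:C * cpow t c).

Let is_cderive_q (t : R) : 0 < t -> w1 t != 0 -> is_cderive q t (W t / (w1 t * w1 t)).
Proof.
move=> t0 wn0; apply: is_cderive_eq (is_cderiveM (is_cderive_d t0)
  (is_cderiveV wn0 (dw h1 t0))) _.
by rewrite /W; field.
Qed.

Let E_k (t : R) : 0 < t -> E t = k.
Proof. by move=> t0; apply: (is_cderive0_cst is_cderive_E). Qed.

Let is_cderive_r (t : R) : 0 < t -> w1 t != 0 ->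
  is_cderive r t (k / (g1 t * g1 t) + r t * (c / t%:C - 1)).
Proof.
move=> t0 wn0; have n0 := real_complex_neq0 t0.
have hc := is_cderive_cpow (u := id) c t0 (is_derive_id t 1).
apply: is_cderive_eq (is_cderiveM (is_cderive_q t0 wn0)
  (is_cderiveM (is_cderive_expRN t) hc)) _.
rewrite -(E_k t0) /E /r /g1 /= mulr1 cpowN.
have -> : cpow t b = cpow t c * cpow t a * cpow t a.
  by rewrite -!cpowD /c; congr cpow; ring.
have an0 := cpow_neq0 t a.
by field; rewrite n0 wn0 an0.
Qed.

(** The weight [e^(-t) t^c] is bounded on the range considered, by [ln1D_linear_bound] with slope 1,
    so the smallness of [q] passes to [r]. *)
Let r_small (e : R) : 0 < e -> exists2 M, 1 < M & forall t, M < t -> normc (r t) < e.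
Proof.
move=> e0; have [K hK] := ln1D_linear_bound `|Re c| (@ltr01 R).
have K0 : 0 < e / expR K by rewrite divr_gt0 ?expR_gt0.
have [M M1 hM] := q_small K0.
exists M => // t Mt; have [_ _ qt] := hM _ Mt.
rewrite /r Normc.normcM [normc (_ * cpow _ _)]Normc.normcM normc_real ger0_norm ?expR_ge0// normc_cpow -expRD.
have t0 : 0 < t by lra.
have t1 : 1 <= t by lra.
have l0 : 0 <= ln t by rewrite ln_ge0.
have l1 : ln t <= ln (1 + t) by rewrite ler_ln ?posrE ?lerDr// addr_gt0.
have b1 : expR (- t + Re c * ln t) <= expR K.
  rewrite ler_expR; have := hK _ t0; rewrite mul1r.
  have := ler_wpM2r l0 (ler_norm (Re c)); have := ler_wpM2l (normr_ge0 (Re c)) l1.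
  by lra.
rewrite ltr_pdivlMr ?expR_gt0// in qt.
by apply: le_lt_trans qt; rewrite ler_wpM2l ?normc_ge0.
Qed.

Let k0 : k = 0.
Proof.
have [T T1 hT] := q_small (@ltr01 R).
apply: (@cderive_limit0 R r (fun t => k / (g1 t * g1 t) + r t * (c / t%:C - 1)) k T).
- by move=> t Tt; have [? _ _] := hT _ Tt; apply: is_cderive_r => //; lra.
- by move=> e /r_small[M _ hM]; exists M.
move=> e e0.
(* The 10 is [(5 / 2) / (1 / 4)]: eventually [|g1 + 1| <= 5 / 2] and [|g1|^2 >= 1 / 4] in
   [k (1 - g1^2) / g1^2]. The factor [|c| + 1] bounds [|c / t - 1|] for [t >= 1]. *)
pose e1 := e / 2 / (10 * (normc k + 1)); pose e2 := e / 2 / (normc c + 1).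
have nk := normc_ge0 k; have nc := normc_ge0 c.
have e10 : 0 < e1 by rewrite divr_gt0 ?divr_gt0//; lra.
have e20 : 0 < e2 by rewrite divr_gt0 ?divr_gt0//; lra.
have [M1 M11 hM1] := near_g1 e10.
have [M2 M21 hM2] := r_small e20.
have [M3 M31 hM3] := near_g1 (ltac:(lra) : 0 < 1 / 2 :> R).
exists (T + M1 + M2 + M3) => t Mt.
have [wn0 g12 _] := hT t (ltac:(lra)).
have u1 := hM1 t (ltac:(lra)); have u2 := hM2 t (ltac:(lra)); have u3 := hM3 t (ltac:(lra)).
have gn0 : g1 t != 0 by rewrite -normc_eq0 gt_eqF//; lra.
have t1 : 1 <= t by lra.
have -> : k / (g1 t * g1 t) + r t * (c / t%:C - 1) - k =
    k * (- (g1 t - 1) * (g1 t + 1)) / (g1 t * g1 t) + r t * (c / t%:C - 1).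
  have tn0 := real_complex_neq0 (lt_le_trans ltr01 t1).
  move: (g1 t) gn0 (r t) => x x0 y; field.
  by rewrite tn0 x0.
apply: le_lt_trans (le_normcD _ _) _.
have v1 : normc (k * (- (g1 t - 1) * (g1 t + 1)) / (g1 t * g1 t)) <= e / 2.
  rewrite Normc.normcM Normc.normcV ler_pdivrMr; last first.
    by rewrite lt_neqAle normc_ge0 eq_sym normc_eq0 mulf_neq0.
  rewrite Normc.normcM [normc (- _ * _)]Normc.normcM normcN [normc (g1 t * _)]Normc.normcM.
  have p1 : normc (g1 t + 1) <= 5 / 2.
    have := le_normcD (g1 t - 1) 2; rewrite (_ : g1 t - 1 + 2 = g1 t + 1); last by ring.
    rewrite (_ : 2 = 2%:C); last by rewrite rmorph_nat.
    by rewrite normc_real ger0_norm//; lra.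
  have s1 : normc k * e1 <= e / 20.
    rewrite /e1 mulrA ler_pdivrMr; last lra.
    by rewrite (_ : e / 20 * _ = e / 2 * (normc k + 1)); [nra|field].
  have p0 := normc_ge0 (g1 t + 1); have pm := normc_ge0 (g1 t - 1).
  have s2 := ler_pM pm p0 (ltW u1) p1.
  have s3 := ler_wpM2l nk s2.
  have s4 : e / 2 * (1 / 2 * (1 / 2)) <= e / 2 * (normc (g1 t) * normc (g1 t)).
    by rewrite ler_wpM2l ?ler_pM// ?divr_ge0// ltW.
  by apply: le_trans s4; apply: le_trans s3 _; rewrite mulrA; lra.
have v2 : normc (r t * (c / t%:C - 1)) < e / 2.
  rewrite Normc.normcM.
  have ct : normc (c / t%:C - 1) <= normc c + 1.
    apply: le_trans (le_normcD _ _) _; rewrite normcN Normc.normc1 lerD2r.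
    rewrite Normc.normcM Normc.normcV normc_real ler_pdivrMr ?normr_gt0 ?gt_eqF//; last lra.
    by rewrite ler_peMr// ger0_norm//; lra.
  apply: (@le_lt_trans _ _ (normc (r t) * (normc c + 1))).
    by rewrite ler_wpM2l ?normc_ge0.
  by rewrite -ltr_pdivlMr//; lra.
by rewrite [ltRHS](splitr e); exact: ler_ltD.
Qed.

Let W0 (t : R) : 0 < t -> W t = 0.
Proof.
move=> t0; have /eqP := E_k t0; rewrite k0 /E !mulf_eq0 (negbTE (cpow_neq0 _ _)) orbF.
have -> : ((expR (- t))%:C == 0 :> R[i]) = false.
  by apply/negbTE/real_complex_neq0; exact: expR_gt0.
by move=> /eqP.
Qed.

Let d_eventually0 : exists2 M, 1 < M & forall t, M < t -> d t = 0.
Proof.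
have [M M1 hM] := q_small (@ltr01 R); exists M => // t Mt.
suff : q t = 0.
  have [wn0 _ _] := hM t Mt.
  by rewrite /q => /eqP; rewrite mulf_eq0 invr_eq0 (negbTE wn0) orbF => /eqP.
have dq (s : R) : M < s -> is_cderive q s 0.
  move=> Ms; have [wn0 _ _] := hM s Ms; have s0 : 0 < s by lra.
  by apply: is_cderive_eq (is_cderive_q s0 wn0) _; rewrite W0// mul0r.
apply/eqP; rewrite -normc_eq0 -normr_le0 ger0_norm ?normc_ge0//.
apply/ler_addgt0Pl => e e0; rewrite addr0.
have [N N1 hN] := q_small e0.
have [_ _] := hN (N + M + 1) (ltac:(lra)).
have t0 : M < N + M + 1 by lra.
by rewrite (is_cderive0_cst dq t0 Mt) => /ltW.
Qed.

Lemma is_tricomiU_unique (t : R) : 0 < t -> w1 t = w2 t.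
Proof.
move=> t0; have [M M1 hM] := d_eventually0.
suff /eqP : d t = 0 by rewrite subr_eq0 eq_sym => /eqP.
pose T := t + M + 1.
have MT : M < T by rewrite /T; lra.
have T0 : 0 < T by rewrite /T; lra.
have dT : d' T = 0.
  rewrite -(is_cderive_cderive (is_cderive_d T0)).
  apply: is_cderive_cderive; apply: near_eq_is_cderive (is_cderive_cst 0 T).
  by apply: filterS (lt_nbhsr MT) => x Mx; rewrite hM.
have nb := normc_ge0 b; have na := normc_ge0 a.
(* For [s] in [[t, T]], solving the equation for [d''] costs a factor [1 / s <= 1 / t], and
   [|b - s| <= |b| + T]. *)
apply: (@cderive2_zero_backward R d d' d'' t T (normc a / t) ((normc b + T) / t)) => //.
- by rewrite /T; lra.
- by rewrite divr_ge0// ltW.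
- by rewrite divr_ge0 ?(ltW t0)// addr_ge0// ltW.
- by move=> s /andP[ts _]; apply: is_cderive_d; exact: lt_le_trans ts.
- by move=> s /andP[ts _]; apply: is_cderive_d'; exact: lt_le_trans ts.
- move=> s /andP[ts sT]; have s0 : 0 < s by exact: lt_le_trans ts.
  have -> : d'' s = (a * d s - (b - s%:C) * d' s) / s%:C.
    by rewrite -ode_d//; field; exact: real_complex_neq0.
  rewrite Normc.normcM Normc.normcV normc_real (ger0_norm (ltW s0)) ler_pdivrMr//.
  apply: le_trans (le_normcD _ _) _; rewrite normcN !Normc.normcM.
  have bs : normc (b - s%:C) <= normc b + T.
    apply: le_trans (le_normcD _ _) _; rewrite normcN normc_real (ger0_norm (ltW s0)).
    by rewrite lerD2l.
  have n0 := normc_ge0 (d s); have n1 := normc_ge0 (d' s).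
  have st : 1 <= s / t by rewrite ler_pdivlMr// mul1r.
  have k1 := ler_wpM2r n1 bs.
  have k2 : 0 <= normc a * normc (d s) by rewrite mulr_ge0.
  have k3 : 0 <= (normc b + T) * normc (d' s) by rewrite mulr_ge0// addr_ge0// ltW.
  have := ler_wpM2r (addr_ge0 k2 k3) st; rewrite mul1r => k4.
  apply: (@le_trans _ _ (s / t * (normc a * normc (d s) + (normc b + T) * normc (d' s)))).
    by lra.
  by rewrite le_eqVlt; apply/orP; left; apply/eqP; ring.
- exact: hM.
Qed.

End TricomiUniqueness.

(** * The Laplace integral representation of Tricomi's function *)

Section TricomiExistence.
Context {R : realType}.
Variables (a b : R[i]).
Hypothesis a0 : 0 < Re a.

Lemma is_tricomiU_laplace : is_tricomiU a b
  (fun t => (Gamma a)^-1 * claplace (tricomi_kernel a (b - a - 1)) t).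
Proof.
set be := b - a - 1; set kk := tricomi_kernel a be.
have L0 : claplaceable kk := claplaceable_tricomi_kernel be a0.
have L1 := claplaceableX L0.
set w := fun t => _.
have G0 := Gamma_neq0 a0.
have dw (t : R) : 0 < t ->
    is_cderive w t ((Gamma a)^-1 * - claplace (fun s => s%:C * kk s) t).
  by move=> t0; apply: is_cderiveZ; exact: is_cderive_claplace.
have ddw (t : R) : 0 < t -> is_cderive (cderive w) t
    ((Gamma a)^-1 * - - claplace (fun s => s%:C * (s%:C * kk s)) t).
  move=> t0.
  (* The formula for [cderive w] holds only at positive arguments, hence near [t]; this local
     equality is enough to differentiate it again. *)
  apply: (@near_eq_is_cderive _
    (fun t => (Gamma a)^-1 * - claplace (fun s => s%:C * kk s) t)).
    apply: filterS (lt_nbhsr t0) => x x0.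
    by rewrite (is_cderive_cderive (dw _ x0)).
  by apply: is_cderiveZ; apply: is_cderiveN; exact: is_cderive_claplace.
split=> [t t0|].
  split; [exact: is_cderive_cderivable (dw _ t0)|exact: is_cderive_cderivable (ddw _ t0)|].
  rewrite (is_cderive_cderive (ddw _ t0)) (is_cderive_cderive (dw _ t0)) /w.
  have := tricomi_kernel_moments be a0 t0; rewrite -/kk /=.
  rewrite (_ : a + be + 1 = b); last by rewrite /be; ring.
  move=> M; rewrite -[RHS](mulr0 (Gamma a)^-1) -M; ring.
have h := claplace_tricomi_kernel_asymp be a0.
have hg : normc (Gamma a)^-1 *
    normc (cpow t a * claplace kk t - Gamma a) @[t --> +oo] --> (0 : R).
  rewrite -[X in _ --> X](mulr0 (normc (Gamma a)^-1)).
  by apply: cvgM h; exact: cvg_cst.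
apply: cvg_trans hg; apply: near_eq_cvg; apply: nearW => t.
rewrite -Normc.normcM cpowN invrK mulrBr mulVf//; congr (normc (_ - _)).
by rewrite /w; ring.
Qed.

Lemma tricomiU_laplace (t : R) : 0 < t ->
  tricomiU a b t = (Gamma a)^-1 * claplace (tricomi_kernel a (b - a - 1)) t.
Proof.
(* Existence of one solution rules out the default value of [xget]. *)
move=> t0; have h : is_tricomiU a b (tricomiU a b).
  by apply: xgetPex; eexists; exact: is_tricomiU_laplace.
exact: (is_tricomiU_unique h is_tricomiU_laplace t0).
Qed.

End TricomiExistence.

(** * Fubini's theorem on a product set under a product majorant *)

Section RealFubini.
Context {R : realType}.
Local Notation mu := (@lebesgue_measure R).
Variables (A B : set R) (f : R * R -> R) (g1 g2 : R -> R).
Hypotheses (mA : measurable A) (mB : measurable B) (mf : measurable_fun setT f).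
Hypotheses (ig1 : mu.-integrable A (EFin \o g1)) (ig2 : mu.-integrable B (EFin \o g2)).
Hypothesis fg : forall x y, A x -> B y -> `|f (x, y)| <= g1 x * g2 y.

(** Extension by zero, so that the theorems of Tonelli and Fubini are applied on the whole plane. *)
Let ft : R * R -> \bar R := (EFin \o f) \_ (A `*` B).

Let mft : measurable_fun setT ft.
Proof.
apply/(measurable_restrictT _ _).1; first exact: measurableX.
by apply/measurable_EFinP; exact: measurable_funTS.
Qed.

(** The bound [fg] says nothing about the signs of [g1] and [g2] separately; absolute values make
    each factor nonnegative, so that constants can be taken out of Tonelli's iterated integral. *)
Let h1 : R -> \bar R := (abse \o (EFin \o g1)) \_ A.
Let h2 : R -> \bar R := (abse \o (EFin \o g2)) \_ B.

Let h1_ge0 x : (0 <= h1 x)%E.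
Proof. by apply: erestrict_ge0 => y _; exact: abse_ge0. Qed.

Let h2_ge0 x : (0 <= h2 x)%E.
Proof. by apply: erestrict_ge0 => y _; exact: abse_ge0. Qed.

Let mh1 : measurable_fun setT h1.
Proof.
apply/(measurable_restrictT _ _).1 => //.
by apply: measurableT_comp => //; case/integrableP : ig1.
Qed.

Let mh2 : measurable_fun setT h2.
Proof.
apply/(measurable_restrictT _ _).1 => //.
by apply: measurableT_comp => //; case/integrableP : ig2.
Qed.

Let ft_le x y : (`|ft (x, y)| <= h1 x * h2 y)%E.
Proof.
rewrite /ft /h1 /h2 !patchE.
have [xA|xA] := boolP (x \in A); have [yB|yB] := boolP (y \in B).
- rewrite mem_set; last by split; exact: set_mem.
  rewrite /= lee_fin -normrM (le_trans (fg (set_mem xA) (set_mem yB)))//.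
  exact: ler_norm.
- by rewrite memNset ?mule0 ?abse0// => -[_ /mem_set]; rewrite (negbTE yB).
- by rewrite memNset ?mul0e ?abse0// => -[/mem_set]; rewrite (negbTE xA).
- by rewrite memNset ?mul0e ?abse0// => -[/mem_set]; rewrite (negbTE xA).
Qed.

Let ift : (mu \x mu)%E.-integrable setT ft.
Proof.
apply: (iffRL (integrable12ltyP mu mu mft)).
apply: (@le_lt_trans _ _ (\int[mu]_x \int[mu]_y (h1 x * h2 y))%E).
  apply: ge0_le_integral => //.
  - by move=> x _; exact: integral_ge0.
  - apply: (@measurable_fun_fubini_tonelli_F _ _ _ _ R mu (abse \o ft)) => //=.
    exact: measurableT_comp.
  - under eq_fun do rewrite ge0_integralZl//.
    exact: emeasurable_funM.
  - move=> x _; apply: ge0_le_integral => //.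
    + by apply: measurableT_comp => //; apply: measurableT_comp.
    + exact: emeasurable_funM.
have i1 : (\int[mu]_x h1 x < +oo)%E.
  by rewrite /h1 -integral_mkcond; case/integrableP : ig1.
have i2 : (\int[mu]_x h2 x < +oo)%E.
  by rewrite /h2 -integral_mkcond; case/integrableP : ig2.
under eq_integral do rewrite ge0_integralZl//.
rewrite ge0_integralZr//; last exact: integral_ge0.
by rewrite lte_mul_pinfty ?integral_ge0// ge0_fin_numE ?integral_ge0.
Qed.

(** Integrability holds at every point of [A], not just almost everywhere, because [g1 x] is a real
    number. The inner extended integral is thus finite and [fine] loses nothing. *)
Let section_integrable x : A x -> mu.-integrable B (fun y => (f (x, y))%:E).
Proof.
move=> Ax; apply: le_integrable (integrable_EFinZl (g1 x) mB ig2) => //.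
  apply/measurable_EFinP/measurable_funTS.
  exact: measurableT_comp.
move=> y By /=; rewrite lee_fin (le_trans (fg Ax By))//; exact: ler_norm.
Qed.

Let fubini_FE : fubini_F mu ft =
  (EFin \o (fun x => \int[mu]_(y in B) f (x, y))) \_ A.
Proof.
apply/funext => x; rewrite patchE /fubini_F; case: ifPn => xA.
  rewrite /= fineK; last by apply: integrable_fin_num => //; apply: section_integrable; exact: set_mem.
  rewrite [RHS]integral_mkcond; apply: eq_integral => y _.
  rewrite /ft !patchE; have [yB|yB] := boolP (y \in B).
    by rewrite mem_set//; split; exact: set_mem.
  by rewrite memNset// => -[_ /mem_set]; rewrite (negbTE yB).
apply: integral0_eq => y _; rewrite /ft patchE memNset// => -[/mem_set].
by rewrite (negbTE xA).
Qed.

Let section_integrable' y : B y -> mu.-integrable A (fun x => (f (x, y))%:E).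
Proof.
move=> By; apply: le_integrable (integrable_EFinZl (g2 y) mA ig1) => //.
  apply/measurable_EFinP/measurable_funTS.
  exact: measurableT_comp.
move=> x Ax /=; rewrite lee_fin (le_trans (fg Ax By))// mulrC; exact: ler_norm.
Qed.

Let fubini_GE : fubini_G mu ft =
  (EFin \o (fun y => \int[mu]_(x in A) f (x, y))) \_ B.
Proof.
apply/funext => y; rewrite patchE /fubini_G; case: ifPn => yB.
  rewrite /= fineK; last by apply: integrable_fin_num => //; apply: section_integrable'; exact: set_mem.
  rewrite [RHS]integral_mkcond; apply: eq_integral => x _.
  rewrite /ft !patchE; have [xA|xA] := boolP (x \in A).
    by rewrite mem_set//; split; exact: set_mem.
  by rewrite memNset// => -[/mem_set]; rewrite (negbTE xA).
apply: integral0_eq => x _; rewrite /ft patchE memNset// => -[_ /mem_set].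
by rewrite (negbTE yB).
Qed.

Lemma integrable_section_integral :
  mu.-integrable A (fun x => (\int[mu]_(y in B) f (x, y))%:E).
Proof.
have h : mu.-integrable setT (fubini_F mu ft) by exact: integrable_fubini_F ift.
rewrite fubini_FE in h.
exact: (iffRL (@integrable_mkcond _ _ _ mu A
  (EFin \o (fun x => \int[mu]_(y in B) f (x, y))) mA) h).
Qed.

Lemma Rintegral_Fubini :
  \int[mu]_(x in A) \int[mu]_(y in B) f (x, y) =
  \int[mu]_(y in B) \int[mu]_(x in A) f (x, y).
Proof.
apply: (congr1 fine).
transitivity (\int[mu]_x fubini_F mu ft x)%E.
  by rewrite fubini_FE [LHS]integral_mkcond.
transitivity (\int[mu]_y fubini_G mu ft y)%E.
  by rewrite (integral12_prod_meas1 ift) -(integral21_prod_meas1 ift).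
by rewrite fubini_GE [RHS]integral_mkcond.
Qed.

End RealFubini.

Section ComplexFubini.
Context {R : realType}.
Local Notation mu := (@lebesgue_measure R).
Variables (A B : set R) (f : R -> R -> R[i]) (g1 g2 : R -> R).
Hypotheses (mA : measurable A) (mB : measurable B).
Hypotheses (mf : cmeasurable (fun z : R * R => f z.1 z.2)).
Hypotheses (ig1 : mu.-integrable A (EFin \o g1)) (ig2 : mu.-integrable B (EFin \o g2)).
Hypothesis fg : forall x y, A x -> B y -> normc (f x y) <= g1 x * g2 y.

Let fgR x y : A x -> B y -> `|Re (f x y)| <= g1 x * g2 y.
Proof. by move=> Ax By; apply: le_trans (normr_Re_le _) (fg Ax By). Qed.

Let fgI x y : A x -> B y -> `|Im (f x y)| <= g1 x * g2 y.
Proof. by move=> Ax By; apply: le_trans (normr_Im_le _) (fg Ax By). Qed.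

Lemma cintegrable_cintegral : cintegrable A (fun x => cintegral B (f x)).
Proof.
by split; [exact: (integrable_section_integral mA mB mf.1 ig1 ig2 fgR)
          |exact: (integrable_section_integral mA mB mf.2 ig1 ig2 fgI)].
Qed.

Lemma cintegral_Fubini :
  cintegral A (fun x => cintegral B (f x)) =
  cintegral B (fun y => cintegral A (f ^~ y)).
Proof.
apply: complex_ext; [exact: (Rintegral_Fubini mA mB mf.1 ig1 ig2 fgR)
                    |exact: (Rintegral_Fubini mA mB mf.2 ig1 ig2 fgI)].
Qed.

End ComplexFubini.

(** * The integral Whittaker function *)

Section IntegralWhittaker.
Context {R : realType}.
Local Notation mu := (@lebesgue_measure R).

(** The exponent [m] may have any sign: beyond [x] one has [|ln t| <= ln (1 + t) + |ln x|], so [t^m]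
    is at most a constant times [(1 + t)^|m|]. The kernel lemma then applies with exponent [1 - 1]
    at 0. *)
Lemma integrable_exp_tail (x m c : R) : 0 < x -> 0 < c ->
  mu.-integrable `]x, +oo[ (EFin \o (fun t => expR (m * ln t - c * t))).
Proof.
move=> x0 c0.
have xs : (`]x, +oo[%classic : set R) `<=` `]0, +oo[%classic.
  by move=> t; rewrite /= !in_itv/= !andbT; exact: lt_trans.
have h : mu.-integrable `]x, +oo[
    (EFin \o (fun t => expR ((1 - 1) * ln t + `|m| * ln (1 + t) - c * t))).
  by apply: (@integrableS _ _ _ mu `]0, +oo[) => //; exact: integrable_ln_kernel.
apply: le_integrable (integrable_EFinZl (expR (`|m| * `|ln x|)) _ h) => //.
  apply/measurable_EFinP/measurable_funTS.
  have := @measurable_ln_kernel R m 0 c.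
  by under eq_fun do rewrite mul0r addr0.
move=> t /=; rewrite in_itv/= andbT => xt; have t0 : 0 < t by exact: lt_trans xt.
rewrite lee_fin ger0_norm ?expR_ge0// (le_trans _ (ler_norm _))//.
rewrite -expRD ler_expR subrr mul0r add0r.
have l1 : ln t <= ln (1 + t) by rewrite ler_ln ?posrE ?lerDr// addr_gt0.
have l0 : 0 <= ln (1 + t) by rewrite ln_ge0// lerDl ltW.
have l2 : ln x <= ln t by rewrite ler_ln ?posrE// ltW.
have l3 : `|ln t| <= ln (1 + t) + `|ln x|.
  by rewrite ler_norml; have := ler_norm (- ln x); have := normr_ge0 (ln x); rewrite normrN => ? ?; apply/andP; split; lra.
have := ler_wpM2l (normr_ge0 m) l3; have := ler_norm (m * ln t).
by rewrite normrM mulrDr; lra.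
Qed.

Variables (x : R) (kappa m : R[i]).
Hypotheses (x0 : 0 < x) (a0 : 0 < Re (2^-1 + m - kappa)).

Let a := 2^-1 + m - kappa.
Let be := 1 + 2 * m - a - 1.

Let cpow_exp_tail c : 0 < c ->
  cintegrable `]x, +oo[ (fun t : R => cpow t (m - 2^-1) * (expR (- (c * t)))%:C).
Proof.
move=> c0; apply: le_cintegrable (integrable_exp_tail (Re (m - 2^-1)) x0 c0) _ => //.
  apply: cmeasurableM; first by apply: cmeasurable_cpow; exact: measurable_id.
  by apply: cmeasurable_real; exact: measurable_expR_lin.
move=> t _; rewrite Normc.normcM normc_real ger0_norm ?expR_ge0// normc_cpow.
by rewrite -expRD.
Qed.

(* The substitution v = (s + 1/2) t in the upper incomplete gamma function. *)
Let upper_Gamma_scale (s : R) : 0 < s ->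
  upper_Gamma (2^-1 + m) (x * (s + 2^-1)) = cpow (2^-1 + s) (m + 2^-1) *
  cintegral `]x, +oo[ (fun t : R => cpow t (m - 2^-1) * (expR (- ((2^-1 + s) * t)))%:C).
Proof.
move=> s0; have c0 : 0 < 2^-1 + s by rewrite addr_gt0// invr_gt0.
have mE : 2^-1 + m - 1 = m - 2^-1 by field.
have tE (t : R) : `]x, +oo[%classic t ->
    cpow (2^-1 + s) (m - 2^-1) * (cpow t (m - 2^-1) * (expR (- ((2^-1 + s) * t)))%:C) =
    cpow ((2^-1 + s) * t) (m - 2^-1) * (expR (- ((2^-1 + s) * t)))%:C.
  rewrite /= in_itv/= andbT => xt; have t0 : 0 < t by exact: lt_trans xt.
  by rewrite cpowMl// mulrA.
rewrite /upper_Gamma mE mulrC [s + _]addrC cintegral_scale//.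
- rewrite -(eq_cintegral tE) cintegralZ//; last exact: cpow_exp_tail.
  rewrite mulrA -{1}(cpow1 c0) -cpowD; congr (cpow _ _ * _); by field.
- apply: cmeasurableM; first by apply: cmeasurable_cpow; exact: measurable_id.
  by apply: cmeasurable_real; exact: measurable_expRN.
- apply: eq_cintegrable tE _ => //; apply: cintegrableZ => //.
  exact: cpow_exp_tail.
Qed.

(** The integrand common to both iterated integrals, up to the factor [1 / Gamma a]. Division by [t]
    in [wi] lowers the exponent [m + 1/2] to [m - 1/2]. *)
Let H (t s : R) : R[i] := (expR (- (2^-1 * t)))%:C * cpow t (m - 2^-1) *
  ((expR (- (t * s)))%:C * tricomi_kernel a be s).

Let cmeasurable_H : cmeasurable (fun z : R * R => H z.1 z.2).
Proof.
have comp (f : R -> R[i]) (u : R * R -> R) : measurable_fun setT u ->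
    cmeasurable f -> cmeasurable (fun z => f (u z)).
  by move=> mu [f1 f2]; split; [exact: measurableT_comp f1 mu|exact: measurableT_comp f2 mu].
apply: cmeasurableM; apply: cmeasurableM.
- apply: (comp (fun t => (expR (- (2^-1 * t)))%:C) fst); first exact: measurable_fst.
  by apply: cmeasurable_real; exact: measurable_expR_lin.
- by apply: cmeasurable_cpow; exact: measurable_fst.
- apply: (comp (fun t => (expR (- t))%:C) (fun z => z.1 * z.2)).
    by apply: measurable_funM; [exact: measurable_fst|exact: measurable_snd].
  by apply: cmeasurable_real; exact: measurable_expRN.
- apply: (comp (tricomi_kernel a be) snd); first exact: measurable_snd.
  exact: cmeasurable_tricomi_kernel.
Qed.

Let g1 (t : R) := expR (Re (m - 2^-1) * ln t - 2^-1 * t).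
Let g2 (s : R) := expR ((Re a - 1) * ln s + Re be * ln (1 + s) - x * s).

Let ig1 : mu.-integrable `]x, +oo[ (EFin \o g1).
Proof. by apply: integrable_exp_tail => //; rewrite invr_gt0. Qed.

Let ig2 : mu.-integrable `]0, +oo[ (EFin \o g2).
Proof. exact: integrable_ln_kernel. Qed.

(** Bounding [e^(- t s)] by [e^(- x s)] separates the variables: [g1] keeps the decay [e^(- t / 2)]
    of the Whittaker prefactor, and [g2] decays at the positive rate [x]. *)
Let H_le (t s : R) : `]x, +oo[%classic t -> `]0, +oo[%classic s ->
  normc (H t s) <= g1 t * g2 s.
Proof.
move=> xt /gt0_itvP s0; have {}xt : x < t by move: xt; rewrite /= in_itv/= andbT.
rewrite /H Normc.normcM normc_tricomi_kernel Normc.normcM normc_real.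
rewrite ger0_norm ?expR_ge0// normc_cpow -!expRD ler_expR.
by have := ler_wpM2r (ltW s0) (ltW xt); lra.
Qed.

Let inner_s (t : R) : 0 < t ->
  wi_integrand kappa m t = (Gamma a)^-1 * cintegral `]0, +oo[ (H t).
Proof.
move=> t0; have n0 := real_complex_neq0 t0.
rewrite /wi_integrand /whittakerW -/a tricomiU_laplace// -/be /H cintegralZ//; last first.
  exact: (claplaceable_tricomi_kernel be a0).2.
rewrite -/(claplace _ _).
have -> : cpow t (m + 2^-1) = t%:C * cpow t (m - 2^-1).
  by rewrite -{1}(cpow1 t0) -cpowD; congr cpow; field.
have -> : - t / 2 = - (2^-1 * t) by field.
move: ((Gamma a)^-1) => G; field.
by rewrite n0.
Qed.

Let F (t : R) : R[i] :=
  cpow t (m - kappa - 2^-1) * cpow (1 + t) (m + kappa - 2^-1)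
    / cpow (2^-1 + t) (m + 2^-1) * upper_Gamma (2^-1 + m) (x * (t + 2^-1)).

(** The two exponentials merge into [e^(- (1/2 + s) t)], and the power of [1/2 + s] produced by
    [upper_Gamma_scale] cancels the denominator of [F]. *)
Let inner_t (s : R) : 0 < s -> F s = cintegral `]x, +oo[ (H ^~ s).
Proof.
move=> s0; have c0 : 0 < 2^-1 + s by rewrite addr_gt0// invr_gt0.
have HE (t : R) : `]x, +oo[%classic t -> H t s = tricomi_kernel a be s *
    (cpow t (m - 2^-1) * (expR (- ((2^-1 + s) * t)))%:C).
  move=> _; rewrite /H.
  have -> : - ((2^-1 + s) * t) = - (2^-1 * t) + - (t * s) by ring.
  by rewrite expRD rmorphM /=; ring.
apply: (etrans _ (esym (etrans (eq_cintegral HE)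
  (cintegralZ _ (measurable_itv _) (cpow_exp_tail c0))))).
rewrite /F upper_Gamma_scale// /tricomi_kernel.
have -> : a - 1 = m - kappa - 2^-1 by rewrite /a; field.
have -> : be = m + kappa - 2^-1 by rewrite /be /a; field.
rewrite mulrA; congr (_ * _).
by rewrite divfK ?cpow_neq0.
Qed.

(** The integrability clauses certify that both sides are genuine Lebesgue integrals; they come from
    the same majorant as the exchange. *)
Lemma wi_integral_representation :
  [/\ cintegrable `]x, +oo[ (wi_integrand kappa m),
      cintegrable `]0, +oo[ F &
      wi kappa m x = (Gamma a)^-1 * cintegral `]0, +oo[ F].
Proof.
have mA : measurable (`]x, +oo[%classic : set R) by exact: measurable_itv.
have mB : measurable (`]0, +oo[%classic : set R) by exact: measurable_itv.
have gtx (t : R) : `]x, +oo[%classic t -> 0 < t.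
  by rewrite /= in_itv/= andbT; exact: lt_trans.
have iA := cintegrable_cintegral mA mB cmeasurable_H ig1 ig2 H_le.
(* [cintegrable_cintegral] concerns the first variable, so [H] is transposed to obtain integrability
   in [s]. *)
have swap : cmeasurable (fun z : R * R => H z.2 z.1).
  have ms : measurable_fun [set: R * R] (fun z : R * R => (z.2, z.1)).
    by apply: measurable_fun_pair; [exact: measurable_snd|exact: measurable_fst].
  by split; [exact: measurableT_comp cmeasurable_H.1 ms|exact: measurableT_comp cmeasurable_H.2 ms].
have iB : cintegrable `]0, +oo[ (fun s => cintegral `]x, +oo[ (H ^~ s)).
  apply: (cintegrable_cintegral (f := fun s t => H t s) mB mA swap ig2 ig1) => s t Bs At.
  by rewrite mulrC; exact: H_le.
split.
- apply: eq_cintegrable mA _ (cintegrableZ (Gamma a)^-1 mA iA) => t /gtx t0.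
  by rewrite inner_s.
- by apply: eq_cintegrable mB _ iB => s /gt0_itvP s0; rewrite inner_t.
rewrite /wi (eq_cintegral (g := fun t => (Gamma a)^-1 * cintegral `]0, +oo[ (H t))); last first.
  by move=> t /gtx t0; rewrite inner_s.
rewrite cintegralZ// (cintegral_Fubini mA mB cmeasurable_H ig1 ig2 H_le).
by congr (_ * _); apply: eq_cintegral => s /gt0_itvP s0; rewrite inner_t.
Qed.

End IntegralWhittaker.

Unset Implicit Arguments.

Theorem theorem36 (R : realType) (x : R) (kappa mu : R[i])
    (hx : 0 < x) (ha : 0 < complex.Re (2^-1 + mu - kappa)) :
  let F (t : R) : R[i] :=
    cpow t (mu - kappa - 2^-1) * cpow (1 + t) (mu + kappa - 2^-1)
      / cpow (2^-1 + t) (mu + 2^-1)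
      * upper_Gamma (2^-1 + mu) (x * (t + 2^-1)) in
  [/\ cintegrable `]x, +oo[ (wi_integrand kappa mu),
      cintegrable `]0, +oo[ F &
      wi kappa mu x = (Gamma (2^-1 + mu - kappa))^-1 * cintegral `]0, +oo[ F].
Proof. exact: wi_integral_representation. Qed.
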